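(* Let $T\colon X\to X$ be a continuous map on a compact metric space and let $\Phi=\{\phi_1,\ldots,\phi_d\}$ be a family of continuous functions $\phi_i\colon X\to\mathbb{R}$ such that $(T,\Phi)$ is a $C^r$ regular pair. Let $F\colon L(\Phi)\to\mathbb{R}$ be a strictly concave $C^r$ function such that $E=h+F$ attains its maximum on $\operatorname{int}L(\Phi)$. Then there exists a unique equilibrium measure for $(F,\Phi)$. Moreover, the equilibrium measure is ergodic.
   Context: $\mathcal{M}$ is the set of $T$-invariant Borel probability measures on $X$ with the weak$^*$ topology, $h_\mu(T)$ is the Kolmogorov–Sinai entropy, and $\int_X\Phi\,d\mu=\left(\int_X\phi_1\,d\mu,\ldots,\int_X\phi_d\,d\mu\right)$. Let $$L(\Phi)=\left\{\int_X\Phi\,d\mu:\mu\in\mathcal{M}\right\}\subset\mathbb{R}^d,\qquad \mathcal{M}(z)=\left\{\mu\in\mathcal{M}:\int_X\Phi\,d\mu=z\right\},$$ and define $h\colon L(\Phi)\to\mathbb{R}$ by $h(z)=\sup\{h_\mu(T):\mu\in\mathcal{M}(z)\}$. An equilibrium measure for $(F,\Phi)$ is a measure $\nu\in\mathcal{M}$ attaining the supremum $$\sup_{\mu\in\mathcal{M}}\left\{h_\mu(T)+F\left(\int_X\Phi\,d\mu\right)\right\}.$$ The classical topological pressure of a continuous $\psi\colon X\to\mathbb{R}$ is denoted $P(\psi)$; it satisfies $P(\psi)=\sup_{\mu\in\mathcal{M}}\left(h_\mu(T)+\int_X\psi\,d\mu\right)$, and a classical equilibrium measure for $\psi$ is a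 $\mu\in\mathcal{M}$ attaining this supremum. The pair $(T,\Phi)$ is $C^r$-regular (for some $2\le r\le\omega$, where $\omega$ refers to the analytic case) if: (i) each function in $\operatorname{span}\{\phi_1,\ldots,\phi_d,1\}$ has a unique equilibrium measure with respect to the classical topological pressure; (ii) for each $z\in\operatorname{int}L(\Phi)$ the map $q\mapsto P(\langle q,\Phi-z\rangle)$ is of class $C^r$, is strictly convex, and its second derivative is a positive definite bilinear form for each $q\in\mathbb{R}^d$, where $\langle\cdot,\cdot\rangle$ is the usual inner product; (iii) the entropy map $\mu\mapsto h_\mu(T)$ is upper semicontinuous on $\mathcal{M}$. *)

(* Defs.v *)
From HB Require Import structures.
From mathcomp Require Import all_boot all_order all_algebra finmap.
From mathcomp Require Import all_classical all_reals all_analysis.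
From mathcomp Require Import giry.

Set Implicit Arguments.
Unset Strict Implicit.
Unset Printing Implicit Defensive.

Import Order.TTheory GRing.Theory Num.Theory.
Import numFieldNormedType.Exports.

Local Open Scope classical_set_scope.
Local Open Scope ring_scope.

(** * Differentiability classes on subsets of R^d *)

Inductive smoothness : Type :=
| Cfinite of nat
| Cinfinity
| Comega.

(* 2 <= r <= omega *)
Definition at_least_C2 (r : smoothness) : bool :=
  if r is Cfinite n then (2 <= n)%N else true.

Definition partial (R : realType) (d : nat) (i : 'I_d) (f : 'rV[R]_d -> R) :
    'rV[R]_d -> R :=
  fun x => 'D_(delta_mx 0 i) f x.

(* Iterated partial derivatives up to order n exist and are continuous on U,
   which is meant to be open. *)
Fixpoint Cn_on (R : realType) (d : nat) (n : nat) (U : set 'rV[R]_d)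
    (f : 'rV[R]_d -> R) : Prop :=
  (forall x, U x -> {for x, continuous f}) /\
  if n is m.+1 then
    forall i : 'I_d,
      (forall x, U x -> derivable f x (delta_mx 0 i)) /\
      Cn_on m U (partial i f)
  else True.

Definition power_series_term (R : realType) (d : nat)
    (c : {ffun 'I_d -> nat} -> R) (x : 'rV[R]_d) :
    {ffun 'I_d -> nat} -> \bar R :=
  fun a => (c a * \prod_(i < d) x 0 i ^+ a i)%:E.

(* Around each point of U, f is the sum of an absolutely convergent multiple
   power series; the sum is the difference of those of the positive and negative
   parts of the terms. *)
Definition analytic_on (R : realType) (d : nat) (U : set 'rV[R]_d)
    (f : 'rV[R]_d -> R) : Prop :=
  forall x, U x -> exists c : {ffun 'I_d -> nat} -> R,
    \forall y \near x,
      let u := power_series_term c (y - x) in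
      summable [set: {ffun 'I_d -> nat}] u /\
      ((f y)%:E = \esum_(a in [set: {ffun 'I_d -> nat}]) (u^\+ a)
                  - \esum_(a in [set: {ffun 'I_d -> nat}]) (u^\- a))%E.

Definition Cr_on_open (R : realType) (d : nat) (r : smoothness)
    (U : set 'rV[R]_d) (f : 'rV[R]_d -> R) : Prop :=
  match r with
  | Cfinite n => Cn_on n U f
  | Cinfinity => forall n, Cn_on n U f
  | Comega => analytic_on U f
  end.

(* C^r on an arbitrary subset A of R^d: near each point of A, f|_A is the
   restriction of a C^r function defined on an open set.  The values of f
   outside A are irrelevant. *)
Definition Cr_on (R : realType) (d : nat) (r : smoothness)
    (A : set 'rV[R]_d) (f : 'rV[R]_d -> R) : Prop :=
  forall x, A x -> exists (U : set 'rV[R]_d) (g : 'rV[R]_d -> R),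
    [/\ open U, U x, Cr_on_open r U g & forall y, (A `&` U) y -> f y = g y].

Definition hessian (R : realType) (d : nat) (f : 'rV[R]_d -> R)
    (x : 'rV[R]_d) : 'M[R]_d :=
  \matrix_(i, j) partial i (partial j f) x.

Definition posdef (R : realType) (d : nat) (H : 'M[R]_d) : Prop :=
  forall v : 'rV[R]_d, v != 0 -> 0 < (v *m H *m v^T) 0 0.

Definition strictly_convex_on (R : realType) (d : nat) (A : set 'rV[R]_d)
    (f : 'rV[R]_d -> R) : Prop :=
  forall (x y : 'rV[R]_d) (t : R), A x -> A y -> x != y -> 0 < t < 1 ->
    f (t *: x + (1 - t) *: y) < t * f x + (1 - t) * f y.

Definition strictly_concave_on (R : realType) (d : nat) (A : set 'rV[R]_d)
    (f : 'rV[R]_d -> R) : Prop :=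
  strictly_convex_on A (fun x => - f x).

(** * Invariant measures *)

(* A base point is needed because measurable types are pointed in the library;
   a metric space carrying a probability measure is nonempty anyway. *)
#[short(type="pmetricType")]
HB.structure Definition PointedMetricSpace (K : numDomainType) :=
  {M of Metric K M & isPointed M}.

Notation borel X := (g_sigma_algebraType (@open X)).

Definition invariant_measures (R : realType) (X : pmetricType R) (T : X -> X) :
    set (probability (borel X) R) :=
  [set mu | forall A : set (borel X), measurable A -> mu (T @^-1` A) = mu A].

Definition weak_star (R : realType) (X : pmetricType R) (T : X -> X) :
    topologicalType :=
  initial_topology
    ((fun (mu : set_type (invariant_measures T)) (f : continuousType X R) =>
        \int[val mu]_x f x)
     : set_type (invariant_measures T) -> {ptws continuousType X R -> R}).

(* Probability measures are functions on all subsets, with arbitrary values off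
   the sigma-algebra, hence uniqueness up to [measure_eq]. *)
Definition unique_measure (R : realType) (X : pmetricType R)
    (P : set (probability (borel X) R)) : Prop :=
  exists2 mu, P mu & forall nu, P nu -> measure_eq nu mu.

Definition ergodic (R : realType) (X : pmetricType R) (T : X -> X)
    (mu : probability (borel X) R) : Prop :=
  invariant_measures T mu /\
  forall A : set (borel X), measurable A -> T @^-1` A = A ->
    mu A = 0%E \/ mu A = 1%E.

(** * Kolmogorov-Sinai entropy *)

(* Some of the k cells may be empty. *)
Definition measurable_partition (R : realType) (X : pmetricType R) (k : nat)
    (xi : 'I_k -> set (borel X)) : Prop :=
  [/\ forall i, measurable (xi i),
      trivIset [set: 'I_k] xi
    & \bigcup_i xi i = [set: borel X]].

(* The cells of the join of the T^{-j} xi, 0 <= j < n, are indexed by words. *)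
Definition join_cell (R : realType) (X : pmetricType R) (T : X -> X) (k : nat)
    (xi : 'I_k -> set (borel X)) (n : nat) (w : {ffun 'I_n -> 'I_k}) :
    set (borel X) :=
  [set x | forall j : 'I_n, xi (w j) (iter j T x)].

(* [ln 0 = 0], so that empty cells contribute 0. *)
Definition join_entropy (R : realType) (X : pmetricType R) (T : X -> X)
    (mu : probability (borel X) R) (k : nat) (xi : 'I_k -> set (borel X))
    (n : nat) : R :=
  \sum_(w : {ffun 'I_n -> 'I_k})
    - (fine (mu (join_cell T xi w)) * ln (fine (mu (join_cell T xi w)))).

Definition partition_entropy (R : realType) (X : pmetricType R) (T : X -> X)
    (mu : probability (borel X) R) (k : nat) (xi : 'I_k -> set (borel X)) : R :=
  limn (fun n : nat => n%:R^-1 * join_entropy T mu xi n).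

Definition ks_entropy (R : realType) (X : pmetricType R) (T : X -> X)
    (mu : probability (borel X) R) : \bar R :=
  ereal_sup [set e | exists (k : nat) (xi : 'I_k -> set (borel X)),
    measurable_partition xi /\ e = (partition_entropy T mu xi)%:E].

(** * Classical topological pressure *)

Definition birkhoff_sum (R : realType) (X : Type) (T : X -> X) (psi : X -> R)
    (n : nat) (x : X) : R :=
  \sum_(j < n) psi (iter j T x).

(* On a compact space (n, e)-separated sets are automatically finite. *)
Definition separated (R : realType) (X : pmetricType R) (T : X -> X) (n : nat)
    (e : R) (E : {fset X}) : Prop :=
  forall x y, x \in E -> y \in E -> x != y ->
    exists j : 'I_n, e < mdist (iter j T x) (iter j T y).

Definition separated_sum (R : realType) (X : pmetricType R) (T : X -> X)
    (psi : X -> R) (e : R) (n : nat) : \bar R :=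
  ereal_sup [set (\sum_(x <- E) expR (birkhoff_sum T psi n x))%:E
            | E in separated T n e].

Definition pressure (R : realType) (X : pmetricType R) (T : X -> X)
    (psi : X -> R) : \bar R :=
  lim ((fun e : R =>
          limn_esup (fun n : nat =>
            ((n%:R^-1)%:E * lne (separated_sum T psi e n))%E)) @ 0^'+).

Definition classical_equilibrium (R : realType) (X : pmetricType R)
    (T : X -> X) (psi : X -> R) : set (probability (borel X) R) :=
  [set mu | invariant_measures T mu /\
    (ks_entropy T mu + (\int[mu]_x psi x)%:E)%E =
    ereal_sup [set (ks_entropy T nu + (\int[nu]_x psi x)%:E)%E
              | nu in invariant_measures T]].

(** * Nonlinear thermodynamic formalism *)

Definition integral_vector (R : realType) (X : pmetricType R) (d : nat)
    (Phi : 'I_d -> X -> R) (mu : probability (borel X) R) : 'rV[R]_d :=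
  \row_i \int[mu]_x Phi i x.

(* L(Phi) *)
Definition rotation_set (R : realType) (X : pmetricType R) (T : X -> X)
    (d : nat) (Phi : 'I_d -> X -> R) : set 'rV[R]_d :=
  [set integral_vector Phi mu | mu in invariant_measures T].

(* h; meaningful on L(Phi) *)
Definition entropy_function (R : realType) (X : pmetricType R) (T : X -> X)
    (d : nat) (Phi : 'I_d -> X -> R) (z : 'rV[R]_d) : \bar R :=
  ereal_sup [set ks_entropy T mu | mu in
    [set mu | invariant_measures T mu /\ integral_vector Phi mu = z]].

Definition equilibrium_measure (R : realType) (X : pmetricType R) (T : X -> X)
    (d : nat) (F : 'rV[R]_d -> R) (Phi : 'I_d -> X -> R) :
    set (probability (borel X) R) :=
  [set nu | invariant_measures T nu /\
    (ks_entropy T nu + (F (integral_vector Phi nu))%:E)%E =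
    ereal_sup [set (ks_entropy T mu + (F (integral_vector Phi mu))%:E)%E
              | mu in invariant_measures T]].

Definition span_function (R : realType) (X : Type) (d : nat)
    (Phi : 'I_d -> X -> R) (q : 'rV[R]_d) (c : R) : X -> R :=
  fun x => \sum_(i < d) q 0 i * Phi i x + c.

(* <q, Phi - z> *)
Definition inner_shift (R : realType) (X : Type) (d : nat)
    (Phi : 'I_d -> X -> R) (z q : 'rV[R]_d) : X -> R :=
  fun x => \sum_(i < d) q 0 i * (Phi i x - z 0 i).

Definition regular_pair (R : realType) (X : pmetricType R) (T : X -> X)
    (d : nat) (Phi : 'I_d -> X -> R) (r : smoothness) : Prop :=
  [/\ forall (q : 'rV[R]_d) (c : R),
        unique_measure (classical_equilibrium T (span_function Phi q c)),
      forall z : 'rV[R]_d, (rotation_set T Phi)° z ->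
        let Q := fun q : 'rV[R]_d => fine (pressure T (inner_shift Phi z q)) in
        [/\ forall q, pressure T (inner_shift Phi z q) \is a fin_num,
            Cr_on_open r [set: 'rV[R]_d] Q,
            strictly_convex_on [set: 'rV[R]_d] Q
          & forall q, posdef (hessian Q q)]
    & lower_semicontinuous
        (fun mu : weak_star T => (- ks_entropy T (val (mu : set_type (invariant_measures T))))%E)].

(* Main.v *)
Require Import Defs.
From HB Require Import structures.
From mathcomp Require Import all_boot all_order all_algebra finmap.
From mathcomp Require Import all_classical all_reals all_analysis.
From mathcomp Require Import giry measurable_realfun ring lra.

(* Let z be the interior maximiser of h + F.  The Kolmogorov-Sinai entropy is
   affine on invariant measures, so h is concave and has a supergradient at z:
   h(w) + <q, w - z> <= h(z) for some q and all w in L(Phi).  Strict concavity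
   of F forces every equilibrium measure nu of (F, Phi) to have integral z and
   entropy h(z), and then nu is a classical equilibrium measure for <q, Phi>;
   these are unique by regularity.  For existence, the supremum h(z) is attained
   because the entropy is upper semicontinuous and the invariant measures are
   weak* compact: an ultrafilter of measures converges on closed sets to a
   finitely additive content, which induces an outer measure whose
   Caratheodory restriction to the Borel sets is the limit.  Ergodicity follows
   from uniqueness, since affinity turns the conditional measures on an invariant
   set and on its complement into classical equilibrium measures. *)

Set Implicit Arguments.
Unset Strict Implicit.
Unset Printing Implicit Defensive.

Import Order.TTheory GRing.Theory Num.Theory.
Import numFieldNormedType.Exports.

Local Open Scope classical_set_scope.
Local Open Scope ring_scope.

(** * Measures from contents on closed sets *)

Section erode.
Context (R : realType) (X : pmetricType R).

Definition erode (e : R) (U : set X) : set X := [set x | ball x e `<=` U].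

Lemma closed_erode (e : R) (U : set X) : closed (erode e U).
Proof.
rewrite -[erode e U]setCK; apply: open_closedC; rewrite openE => x /= xU.
have [y [xy yU]] : exists y, ball x e y /\ ~ U y.
  apply: contra_notP xU => h y xy; apply: contrapT => yU; apply: h.
  by exists y.
have d0 : 0 < e - mdist x y by move: xy; rewrite ballEmdist/= subr_gt0.
apply/nbhs_ballP; exists (e - mdist x y) => //= x'; rewrite ballEmdist/= => xx'.
move=> /(_ y); apply: contra_not yU; apply; rewrite ballEmdist/=.
by have := metric_triangle x' x y; rewrite (metric_sym x' x); lra.
Qed.

Lemma erode_sub (e : R) (U : set X) : 0 < e -> erode e U `<=` U.
Proof. by move=> e0 x; apply; exact: ballxx. Qed.

Lemma le_erode (e e' : R) (U : set X) : e <= e' -> erode e' U `<=` erode e U.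
Proof. by move=> ee' x xU y /(le_ball ee'); exact: xU. Qed.

Lemma open_bigcup_erode (U : set X) : open U ->
  U = \bigcup_n erode n.+1%:R^-1 U.
Proof.
move=> oU; apply/seteqP; split => [x Ux|x [n _]]; last first.
  by apply: erode_sub; rewrite invr_gt0.
have /nbhs_ballP[e /= e0 xe] : nbhs x U by exact: open_nbhs_nbhs.
have [n ne] : exists n : nat, n.+1%:R^-1 < e.
  have [n _ /(_ n (leqnn n))] := @near_infty_natSinv_lt R (PosNum e0).
  by exists n.
exists n => // y /(le_ball (ltW ne)); exact: xe.
Qed.

Lemma closed_cover_erode (C : set X) (U : (set X)^nat) :
    compact [set: X] -> closed C -> (forall n, open (U n)) ->
    C `<=` \bigcup_n U n ->
  exists N, C `<=` \bigcup_(i in `I_N) erode N.+1%:R^-1 (U i).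
Proof.
move=> cX cC oU CU.
have cptC : compact C by exact: subclosed_compact cC cX _.
pose W N := \bigcup_(i in `I_N) erode N.+1%:R^-1 (U i).
have ndW : {homo W : m n / (m <= n)%N >-> m `<=` n}.
  move=> m n mn x; rewrite /W => -[i /= im xi].
  exists i => /=; first exact: leq_trans mn.
  by apply: le_erode xi; rewrite lef_pV2 ?posrE// ler_nat.
have : C `<=` \bigcup_n (W n)°.
  move=> x /CU[n _ Ux].
  have /nbhs_ballP[e /= e0 xe] : nbhs x (U n) by exact: open_nbhs_nbhs.
  have [m me] : exists m : nat, m.+1%:R^-1 < e / 2.
    have e20 : 0 < e / 2 by rewrite divr_gt0.
    have [m _ /(_ m (leqnn m))] := @near_infty_natSinv_lt R (PosNum e20).
    by exists m.
  exists (maxn m n.+1) => //; apply/nbhs_ballP; exists (e / 2).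
    by rewrite /= divr_gt0.
  move=> y xy; exists n => /=.
    by rewrite leq_max leqnn orbT.
  move=> z yz; apply: xe; rewrite [e]splitr; apply: ball_triangle xy _.
  apply: le_ball yz; apply/ltW/(le_lt_trans _ me).
  by rewrite lef_pV2 ?posrE// ler_nat ltnS leq_maxl.
move: cptC; rewrite compact_cover => /[apply].
case=> [n _|D _ CD]; first exact: open_interior.
exists (\max_(i <- D) i)%N => x /CD[n /= nD] /interior_subset.
by apply: ndW; exact: leq_bigmax_seq.
Qed.

End erode.

Section content_measure.
Context (R : realType) (X : pmetricType R).
Variable pi : set X -> R.
Hypothesis cX : compact [set: X].
Hypothesis pi0 : pi set0 = 0.
Hypothesis piT : pi setT = 1.
Hypothesis le_pi : forall C D, closed C -> closed D -> C `<=` D -> pi C <= pi D.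
Hypothesis piU_le : forall C D, closed C -> closed D ->
  pi (C `|` D) <= pi C + pi D.
Hypothesis piU_ge : forall C D, closed C -> closed D -> C `&` D = set0 ->
  pi C + pi D <= pi (C `|` D).

Local Open Scope ereal_scope.

Definition inner_content (U : set X) : \bar R :=
  ereal_sup [set (pi C)%:E | C in [set C | closed C /\ C `<=` U]].

Definition outer_content (A : set X) : \bar R :=
  ereal_inf [set inner_content U | U in [set U | open U /\ A `<=` U]].

Lemma le_inner_content U V : U `<=` V -> inner_content U <= inner_content V.
Proof.
move=> UV; apply: le_ereal_sup => _ [C [cC CU] <-]; exists C => //.
by split=> //; exact: subset_trans UV.
Qed.

Lemma inner_content_ge0 U : 0 <= inner_content U.
Proof.
apply: ereal_sup_ubound; exists set0; last by rewrite pi0.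
by split=> //; exact: closed0.
Qed.

Lemma inner_content_ge C U : closed C -> C `<=` U -> (pi C)%:E <= inner_content U.
Proof. by move=> cC CU; apply: ereal_sup_ubound; exists C. Qed.

Lemma outer_content_open U : open U -> outer_content U = inner_content U.
Proof.
move=> oU; apply/eqP; rewrite eq_le; apply/andP; split.
  by apply: ereal_inf_lbound; exists U => //; split.
by apply/ereal_infP => _ [V [oV UV] <-]; exact: le_inner_content.
Qed.

Lemma inner_content_bigcup (U : (set X)^nat) : (forall n, open (U n)) ->
  inner_content (\bigcup_n U n) <= \sum_(n <oo) inner_content (U n).
Proof.
move=> oU; apply/ereal_supP => _ [C [cC CU] <-].
have [N CN] := closed_cover_erode cX cC oU CU.
pose E i := C `&` erode N.+1%:R^-1 (U i).
have cE i : closed (E i) by apply: closedI => //; exact: closed_erode.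
have bigE n : closed (\big[setU/set0]_(i < n) E i) /\
    (pi (\big[setU/set0]_(i < n) E i))%:E <= \sum_(i < n) inner_content (U i).
  elim: n => [|n [cn IH]]; first by rewrite !big_ord0 pi0; split => //; exact: closed0.
  rewrite !big_ord_recr /=; split; first exact: closedU.
  apply: le_trans (leeD IH (inner_content_ge (cE n) _)).
    by rewrite -EFinD lee_fin; exact: piU_le.
  by apply: (subset_trans (@subIsetr _ _ _)); apply: erode_sub; rewrite invr_gt0.
have [cN leN] := bigE N.
apply: (@le_trans _ _ (\sum_(i < N) inner_content (U i))).
  apply: (le_trans _ leN); rewrite lee_fin; apply: le_pi => //.
  by rewrite -(bigcup_mkord N E) => x Cx; have [i iN xi] := CN x Cx; exists i.
rewrite -(big_mkord xpredT (fun i => inner_content (U i))).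
by apply: nneseries_lim_ge => n _ _; exact: inner_content_ge0.
Qed.

Lemma outer_content0 : outer_content set0 = 0.
Proof.
rewrite outer_content_open; last exact: open0.
apply/eqP; rewrite eq_le inner_content_ge0 andbT.
by apply/ereal_supP => y [C [cC +]]; rewrite subset0 => -> <-; rewrite pi0.
Qed.

Lemma outer_content_ge0 A : 0 <= outer_content A.
Proof. by apply/ereal_infP => _ [U _ <-]; exact: inner_content_ge0. Qed.

Lemma inner_content_le1 U : inner_content U <= 1.
Proof.
apply/ereal_supP => _ [C [cC _] <-]; rewrite -piT lee_fin; exact: le_pi.
Qed.

Lemma outer_content_fin A : outer_content A \is a fin_num.
Proof.
rewrite ge0_fin_numE ?outer_content_ge0//.
apply: (@le_lt_trans _ _ (inner_content setT)); last first.
  exact: le_lt_trans (inner_content_le1 _) (ltry _).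
by apply: ereal_inf_lbound; exists setT => //; split=> //; exact: openT.
Qed.

Lemma outer_content_sigma_subadditive A F :
  subset_sigma_subadditive outer_content A F.
Proof.
move=> AF; apply/lee_addgt0Pr => e e0.
have ex n : exists U, [/\ open U, F n `<=` U &
    inner_content U <= outer_content (F n) + (e / (2 ^ n.+1)%:R)%:E].
  have en : (0 < e / (2 ^ n.+1)%:R)%R by rewrite divr_gt0// ltr0n expn_gt0.
  have [_ [U [oU FU] <-] lU] := lb_ereal_inf_adherent en (outer_content_fin (F n)).
  by exists U; split => //; exact: ltW.
have /choice[U hU] := ex.
apply: (@le_trans _ _ (\sum_(n <oo) inner_content (U n))).
  apply: le_trans (inner_content_bigcup _); last by move=> n; have [] := hU n.
  apply: ereal_inf_lbound; exists (\bigcup_n U n) => //; split.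
    by apply: bigcup_open => n _; have [] := hU n.
  by apply: (subset_trans AF); apply: subset_bigcup => n _; have [] := hU n.
apply: le_trans (epsilon_trick _ _ (ltW e0)); last by move=> n; exact: outer_content_ge0.
apply: lee_nneseries => [n _ _|n _]; first exact: inner_content_ge0.
by have [] := hU n.
Qed.

HB.instance Definition _ := isSubsetOuterMeasure.Build R X outer_content
  outer_content0 outer_content_ge0 outer_content_sigma_subadditive.

Lemma open_caratheodory U : open U -> outer_content.-caratheodory U.
Proof.
move=> oU; apply: le_caratheodory_measurable => A.
apply/ereal_infP => _ [V [oV AV] <-].
have oVU : open (V `&` U) by exact: openI.
apply/lee_addgt0Pr => e e0.
have e20 : (0 < e / 2)%R by rewrite divr_gt0.
have fin W : inner_content W \is a fin_num.
  rewrite ge0_fin_numE ?inner_content_ge0//.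
  exact: le_lt_trans (inner_content_le1 _) (ltry _).
have [_ [C [cC CVU] <-] lC] := ub_ereal_sup_adherent e20 (fin (V `&` U)).
have oVC : open (V `\` C) by rewrite setDE; apply: openI => //; exact: closed_openC.
have [_ [D [cD DVC] <-] lD] := ub_ereal_sup_adherent e20 (fin (V `\` C)).
have h1 : outer_content (A `&` U) <= (pi C)%:E + (e / 2)%:E.
  apply: (@le_trans _ _ (inner_content (V `&` U))).
    by apply: ereal_inf_lbound; exists (V `&` U) => //; split=> //; exact: setSI.
  by rewrite -leeBlDr//; exact: ltW.
have h2 : outer_content (A `&` ~` U) <= (pi D)%:E + (e / 2)%:E.
  apply: (@le_trans _ _ (inner_content (V `\` C))).
    apply: ereal_inf_lbound; exists (V `\` C) => //; split=> //.
    by move=> x [/AV Vx Ux]; split => // /CVU[].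
  by rewrite -leeBlDr//; exact: ltW.
apply: (le_trans (leeD h1 h2)).
have -> : (pi C)%:E + (e / 2)%:E + ((pi D)%:E + (e / 2)%:E) =
    (pi C + pi D)%:E + e%:E by rewrite addeACA -!EFinD -splitr.
apply: leeD2r; apply: le_trans (@inner_content_ge (C `|` D) V _ _).
- rewrite lee_fin; apply: piU_ge => //.
  by apply/seteqP; split => // x [Cx /DVC[]].
- exact: closedU.
- by move=> x [/CVU[]|/DVC[]].
Qed.

Lemma borel_caratheodory (A : set (borel X)) :
  measurable A -> outer_content.-caratheodory A.
Proof.
move: A; apply: smallest_sub => [|U oU]; last exact: open_caratheodory.
split.
- exact: caratheodory_measurable_set0.
- by move=> A mA; rewrite setTD; exact: caratheodory_measurable_setC.
- exact: caratheodory_measurable_bigcup.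
Qed.

Definition content_measure (A : set (borel X)) : \bar R := outer_content A.

Lemma content_measure0 : content_measure set0 = 0.
Proof. exact: outer_content0. Qed.

Lemma content_measure_ge0 A : 0 <= content_measure A.
Proof. exact: outer_content_ge0. Qed.

Lemma content_measure_sigma : semi_sigma_additive content_measure.
Proof.
move=> F mF tF mUF.
apply: (caratheodory_measure_sigma_additive (mu := outer_content)) => //.
- by move=> n; exact: borel_caratheodory.
- exact: borel_caratheodory.
Qed.

HB.instance Definition _ := isMeasure.Build _ (borel X) R content_measure
  content_measure0 content_measure_ge0 content_measure_sigma.

Lemma content_measureT : content_measure setT = 1.
Proof.
rewrite /content_measure outer_content_open; last exact: openT.
apply/eqP; rewrite eq_le inner_content_le1/= -piT.
by apply: inner_content_ge => //; exact: closedT.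
Qed.

HB.instance Definition _ := Measure_isProbability.Build _ _ _ content_measure
  content_measureT.

Lemma content_probability : exists mu : probability (borel X) R,
  forall U, open U -> mu U = inner_content U.
Proof. by exists content_measure => U oU; exact: outer_content_open. Qed.

End content_measure.

Lemma cvg_ultra_bounded (R : realType) (I : Type) (G : set_system I)
    (f : I -> R) (a b : R) : UltraFilter G ->
  (forall i, a <= f i <= b) -> f @ G --> lim (f @ G).
Proof.
move=> UG fab; suff [p fp] : exists p : R, f @ G --> p by exact: cvgP fp.
have : (f @ G) `[a, b]%classic.
  by apply: (@filterE _ G) => i; rewrite /= in_itv/=; exact: fab.
move/(@segment_compact R a b (f @ G) _) => [p [_ clp]]; exists p => U Up.
have [//|GU] := in_ultra_setVsetC (f @^-1` U) UG.
by have [x []] := clp (~` U) U GU Up.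
Qed.

Section borel_measures.
Context (R : realType) (X : pmetricType R).
Implicit Types mu nu : probability (borel X) R.

Lemma open_measurable_borel (U : set X) : open U ->
  measurable (U : set (borel X)).
Proof. by move=> oU; exact: sub_sigma_algebra. Qed.

Lemma closed_measurable_borel (C : set X) : closed C ->
  measurable (C : set (borel X)).
Proof.
move=> cC; rewrite -[C]setCK; apply: (@measurableC _ (borel X)).
by apply: open_measurable_borel; exact: closed_openC.
Qed.

Lemma continuous_measurable_borel (f : X -> R) : continuous f ->
  measurable_fun [set: borel X] f.
Proof.
move=> /continuousP cf; apply: (measurability _ (RGenOpens.measurableE R)).
move=> _ [_ [a [b ->] <-]]; rewrite setTI; apply: open_measurable_borel.
by apply: cf; exact: interval_open.
Qed.

Lemma continuous_integrable_borel (mu : probability (borel X) R) (f : X -> R) :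
  compact [set: X] -> continuous f -> mu.-integrable [set: borel X] (EFin \o f).
Proof.
move=> cX cf; apply: measurable_bounded_integrable => //.
- by have : (mu setT < +oo)%E by rewrite probability_setT ltry.
- exact: continuous_measurable_borel.
- have := compact_bounded (continuous_compact (continuous_subspaceT cf) cX).
  case=> M [Mr hM]; exists M; split => // y My x _; apply: (hM _ My).
  by exists x.
Qed.

Lemma measure_eq_open_le mu nu :
  (forall U, open U -> (mu U <= nu U)%E) -> measure_eq mu nu.
Proof.
move=> le_open.
have eq_open U : open U -> mu U = nu U.
  move=> oU; apply/eqP; rewrite eq_le le_open//=.
  pose E n := erode n.+1%:R^-1 U.
  have mE n : measurable (E n : set (borel X)).
    by apply: closed_measurable_borel; apply: closed_erode.
  have UE : U = \bigcup_n E n by exact: open_bigcup_erode.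
  have mU : measurable (\bigcup_n E n : set (borel X)).
    by rewrite -UE; exact: open_measurable_borel.
  have ndE : nondecreasing_seq E.
    move=> m n mn; apply/subsetPset; apply: le_erode.
    by rewrite lef_pV2 ?posrE// ler_nat.
  have cmu := nondecreasing_cvg_mu (mu := mu) mE mU ndE.
  have cnu := nondecreasing_cvg_mu (mu := nu) mE mU ndE.
  rewrite UE -(cvg_lim _ cmu)// -(cvg_lim _ cnu)//; apply: lee_lim.
  - by apply/cvg_ex; eexists; exact: cnu.
  - by apply/cvg_ex; eexists; exact: cmu.
  near=> n; rewrite /=.
  have oEC : open (~` E n) by apply: closed_openC; exact: closed_erode.
  have := le_open _ oEC; rewrite !probability_setC//.
  by rewrite leeD2lE// ?leeN2 ?fin_numN ?fin_num_measure.
move=> A mA.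
apply: (@g_sigma_algebra_measure_unique _ R (borel X) open _ (fun=> setT)) => //.
- by move=> U oU; exact: open_measurable_borel.
- by move=> _; exact: openT.
- by apply/seteqP; split => // x _; exists 0%N.
- by move=> U V; exact: openI.
- by move=> _ /=; have : (mu setT < +oo)%E by rewrite probability_setT ltry.
Unshelve. all: by end_near. Qed.

Lemma Rintegral_step mu (a b : R) (N : nat) (U : 'I_N -> set (borel X)) :
    0 <= a -> 0 <= b -> (forall k, measurable (U k)) ->
  (\int[mu]_x (a + b * \sum_(k < N) \1_(U k) x)) =
    a + b * \sum_(k < N) fine (mu (U k)).
Proof.
move=> a0 b0 mU; rewrite /Rintegral.
under eq_integral do rewrite EFinD EFinM -sumEFin.
have mk k : measurable_fun [set: borel X] (fun x => (\1_(U k) x)%:E : \bar R).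
  by apply/measurable_EFinP; exact: measurable_indic.
have mS := emeasurable_sum (index_enum 'I_N) mk.
have S0 x : (0 <= \sum_(k < N) (\1_(U k) x)%:E)%E.
  by apply: sume_ge0 => k _; rewrite lee_fin.
rewrite ge0_integralD//=; last 2 first.
- by move=> x _; rewrite mule_ge0.
- exact: measurable_funeM.
rewrite integral_cst// [X in (_ * X + _)%E](_ : _ = 1%E); last exact: probability_setT.
rewrite mule1 ge0_integralZl_EFin//.
rewrite ge0_integral_sum//.
rewrite (eq_bigr (fun k => (fine (mu (U k)))%:E)) => [|k _].
  by rewrite sumEFin.
transitivity (mu (U k `&` setT)); first exact: integral_indic.
by rewrite setIT fineK// fin_num_measure.
Qed.
End borel_measures.

(** * Weak limits of measures along an ultrafilter *)

Lemma sum_lt_floor (R : realType) (y : R) (N : nat) : 0 <= y ->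
  \sum_(k < N) (k.+1%:R < y)%R%:R <= y /\
  (y <= N%:R -> y <= 1 + \sum_(k < N) (k.+1%:R < y)%R%:R).
Proof.
move=> y0.
suff [h1 h2 _] : [/\ \sum_(k < N) (k.+1%:R < y)%R%:R <= y,
  y <= N%:R -> y <= 1 + \sum_(k < N) (k.+1%:R < y)%R%:R &
  N%:R < y -> \sum_(k < N) (k.+1%:R < y)%R%:R = N%:R :> R] by split.

elim: N => [|N [IH1 IH2 IH3]].
  by rewrite big_ord0; split => // yle0; rewrite addr0 (le_trans yle0).
rewrite big_ord_recr/=; case: ltP => [Ny|yN].
  have /IH3 -> : N%:R < y by apply: lt_trans Ny; rewrite ltr_nat.
  rewrite -natr1; split => //; first by rewrite natr1 ltW.
rewrite addr0; split => // _.
have [/IH2//|Ny] := leP y N%:R.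
by rewrite (IH3 Ny) addrC natr1.
Qed.

Lemma cvg_sum_seq (K : numFieldType) (V : normedModType K) (I J : Type)
    (G : set_system J) (s : seq I) (f : I -> J -> V) (l : I -> V) : Filter G ->
  (forall k, f k @ G --> l k) ->
  (fun j => \sum_(k <- s) f k j) @ G --> \sum_(k <- s) l k.
Proof.
move=> FG fl; elim: s => [|k s IH].
  rewrite big_nil (_ : (fun j => _) = fun=> 0); first exact: cvg_cst.
  by apply/funext => j; rewrite big_nil.
rewrite big_cons (_ : (fun j => _) = fun j => f k j + \sum_(k <- s) f k j).
  exact: cvgD.
by apply/funext => j; rewrite big_cons.
Qed.

Lemma continuous_measurable_map (R : realType) (X : pmetricType R) (T : X -> X) :
  continuous T -> measurable_fun [set: borel X] (T : borel X -> borel X).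
Proof.
move=> /continuousP cT.
apply: (@measurability _ _ (borel X) (borel X) _ _ (@open X)) => // _ [U oU <-].
by rewrite setTI; apply: open_measurable_borel; exact: cT.
Qed.

Lemma continuous_pushforward (R : realType) (X : pmetricType R) (T : X -> X)
    (mu : probability (borel X) R) : continuous T ->
  exists nu : probability (borel X) R, forall A, nu A = mu (T @^-1` A).
Proof.
move=> /continuous_measurable_map mT.
pose T' : {mfun borel X >-> borel X} :=
  HB.pack (T : borel X -> borel X) (isMeasurableFun.Build _ _ _ _ _ mT).
by exists (distribution mu T').
Qed.

Section weak_limit.
Context (R : realType) (X : pmetricType R) (cX : compact [set: X]).

Lemma Rintegral_affine (mu : probability (borel X) R) (g : X -> R) (a b : R) :
  continuous g -> \int[mu]_x (a + b * g x) = a + b * \int[mu]_x g x.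
Proof.
move=> cg; have intg := continuous_integrable_borel mu cX cg.
rewrite RintegralD//.
- rewrite RintegralZl// Rintegral_cst//.
  by rewrite [X in fine X](_ : _ = 1%E) ?mulr1//; exact: probability_setT.
- exact: (continuous_integrable_borel mu cX (@cst_continuous _ _ a)).
- apply: (continuous_integrable_borel mu cX (f := fun x => b * g x)).
  by move=> x; apply: cvgMr; exact: cg.
Qed.

Lemma Rintegral_unit_itv (mu : probability (borel X) R) (g : X -> R) :
  continuous g -> (forall x, 0 <= g x <= 1) -> 0 <= \int[mu]_x g x <= 1.
Proof.
move=> cg g01; have intg := continuous_integrable_borel mu cX cg.
have intc a := continuous_integrable_borel mu cX (@cst_continuous X R a).
have cE a : \int[mu]_x (cst a x) = a.
  rewrite Rintegral_cst//.
  by rewrite [X in fine X](_ : _ = 1%E) ?mulr1//; exact: probability_setT.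
rewrite -{1}(cE 0) -(cE 1); apply/andP.
by split; apply: le_Rintegral => //; try exact: intc; move=> x _; have /andP[] := g01 x.
Qed.

Definition step_sum (mu : probability (borel X) R) (g : X -> R) (N : nat) : R :=
  N.+1%:R^-1 * \sum_(k < N.+1) fine (mu [set x | k.+1%:R < N.+1%:R * g x]).

Lemma Rintegral_step_bounds (mu : probability (borel X) R) (g : X -> R) (N : nat) :
    continuous g -> (forall x, 0 <= g x <= 1) ->
  step_sum mu g N <= \int[mu]_x g x <= N.+1%:R^-1 + step_sum mu g N.
Proof.
move=> cg g01.
have N0 : 0 < N.+1%:R :> R by [].
pose U (k : 'I_N.+1) : set (borel X) := [set x | k.+1%:R < N.+1%:R * g x].
have mU k : measurable (U k).
  apply: open_measurable_borel.
  rewrite (_ : U k = (fun x => N.+1%:R * g x) @^-1` [set y | k.+1%:R < y])//.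
  apply: open_comp; last exact: open_gt.
  move=> x _; apply: cvgMr; exact: cg.
have indE x : \sum_(k < N.+1) \1_(U k) x =
    \sum_(k < N.+1) (k.+1%:R < N.+1%:R * g x)%R%:R :> R.
  by apply: eq_bigr => k _; rewrite indicE; congr (_%:R); congr nat_of_bool;
    rewrite /U mem_setE.
have intg : mu.-integrable [set: borel X] (EFin \o g).
  exact: continuous_integrable_borel.
have intS a b : 0 <= a -> 0 <= b ->
  mu.-integrable [set: borel X]
    (EFin \o (fun x => a + b * \sum_(k < N.+1) \1_(U k) x)).
  move=> a0 b0; apply: measurable_bounded_integrable => //.
  - by have : (mu setT < +oo)%E by rewrite probability_setT ltry.
  - apply: measurable_funD => //; apply: measurable_funM => //.
    apply: (@measurable_sum _ (borel X) R setT _ _ (fun k => \1_(U k))) => k.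
    exact: measurable_indic.
  - exists (a + b * N.+1%:R); split; first exact: num_real.
    move=> M /ltW aM x _; apply: le_trans aM.
    have S0 : 0 <= \sum_(k < N.+1) \1_(U k) x :> R by apply: sumr_ge0.
    rewrite ger0_norm ?addr_ge0 ?mulr_ge0// lerD2l ler_wpM2l//.
    rewrite -[in leRHS](card_ord N.+1) -sum1_card natr_sum ler_sum// => k _.
    by rewrite indicE lern1 leq_b1.
have gb x : \sum_(k < N.+1) \1_(U k) x <= N.+1%:R * g x <= 1 + \sum_(k < N.+1) \1_(U k) x.
  have /andP[g0 g1] := g01 x.
  have Ng0 : 0 <= N.+1%:R * g x by rewrite mulr_ge0.
  have [h1 h2] := sum_lt_floor N.+1 Ng0.
  by rewrite indE h1/= h2// ler_piMr.
have Ni0 : 0 <= N.+1%:R^-1 :> R by rewrite invr_ge0.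
rewrite /step_sum -[X in X <= _]add0r -!Rintegral_step//.
apply/andP; split; apply: le_Rintegral => //; try exact: intS.
- by move=> x _; rewrite add0r ler_pdivrMl//; have /andP[] := gb x.
- move=> x _; have /andP[_] := gb x.
  by rewrite -ler_pdivlMl// mulrDr mulr1.
Qed.

Lemma ultra_limit_measure (I : topologicalType) (G : set_system I)
    (nu : I -> probability (borel X) R) : UltraFilter G ->
  exists mu : probability (borel X) R,
    (forall f : X -> R, continuous f ->
      (fun i => \int[nu i]_x f x) @ G --> \int[mu]_x f x) /\
    forall T : X -> X, continuous T ->
      (forall i, invariant_measures T (nu i)) -> invariant_measures T mu.
Proof.
move=> UG.
(* [pi] is only finitely additive; on open sets the limit measure [mu] can be
   smaller.  The layer-cake formula turns [mu U <= pi U] into an inequality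
   between integrals, and replacing [g] by [1 - g] gives equality. *)
pose pi (A : set X) : R := lim ((fun i => fine (nu i A)) @ G).
have fine01 i (A : set (borel X)) : measurable A -> 0 <= fine (nu i A) <= 1.
  move=> mA; rewrite fine_ge0//= -lee_fin fineK ?fin_num_measure//.
  exact: probability_le1.
have piE (A : set (borel X)) : measurable A ->
    (fun i => fine (nu i A)) @ G --> pi A.
  by move=> mA; apply: (cvg_ultra_bounded UG) => i; exact: fine01.
have mO := @open_measurable_borel R X.
have mC := @closed_measurable_borel R X.
have le_pi A B : measurable (A : set (borel X)) -> measurable (B : set (borel X)) ->
    A `<=` B -> pi A <= pi B.
  move=> mA mB AB; apply: (ler_cvg_to (piE _ mA) (piE _ mB)).
  apply: filterE => i; rewrite fine_le ?fin_num_measure//.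
  by apply: le_measure => //; rewrite inE.
have pi_cst A c : measurable (A : set (borel X)) ->
    (forall i, fine (nu i A) = c) -> pi A = c.
  move=> mA Ac; apply: (cvg_unique _ (piE _ mA)) => //.
  by rewrite (_ : (fun i => _) = fun=> c); [exact: cvg_cst|apply/funext].
have piD A B : measurable (A : set (borel X)) -> measurable (B : set (borel X)) ->
    (fun i => fine (nu i A) + fine (nu i B)) @ G --> pi A + pi B.
  by move=> mA mB; exact: cvgD (piE _ mA) (piE _ mB).
have piU A B : measurable (A : set (borel X)) -> measurable (B : set (borel X)) ->
    pi (A `|` B) <= pi A + pi B.
  move=> mA mB; apply: (ler_cvg_to (piE _ (measurableU _ _ mA mB)) (piD _ _ mA mB)).
  apply: filterE => i /=; rewrite -fineD ?fin_num_measure//.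
  rewrite fine_le ?fin_numD ?fin_num_measure//.
    exact: measurableU.
  exact: measureU2.
have piUd A B : measurable (A : set (borel X)) -> measurable (B : set (borel X)) ->
    A `&` B = set0 -> pi A + pi B <= pi (A `|` B).
  move=> mA mB AB; apply: (ler_cvg_to (piD _ _ mA mB) (piE _ (measurableU _ _ mA mB))).
  apply: filterE => i /=; rewrite -fineD ?fin_num_measure//.
  rewrite fine_le ?fin_numD ?fin_num_measure//.
    exact: measurableU.
  by rewrite measureU//.
have [mu muE] : exists mu : probability (borel X) R,
    forall U, open U -> mu U = inner_content pi U.
  apply: content_probability => //.
  - by apply: pi_cst => // i; rewrite measure0.
  - by apply: pi_cst => // i; have -> : nu i setT = 1%E by exact: probability_setT.
  - by move=> C D cC cD; apply: le_pi; exact: mC.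
  - by move=> C D cC cD; apply: piU; exact: mC.
  - by move=> C D cC cD; apply: piUd; exact: mC.
have mu_le U : open U -> fine (mu U) <= pi U.
  move=> oU; rewrite -lee_fin fineK ?fin_num_measure//; last exact: mO.
  rewrite muE//; apply/ereal_supP => _ [C [cC CU] <-]; rewrite lee_fin.
  by apply: le_pi CU; [exact: mC|exact: mO].
pose L (f : X -> R) := lim ((fun i => \int[nu i]_x f x) @ G).
have bdd (f : X -> R) : continuous f -> exists2 M : R, 0 < M & forall x, `|f x| <= M.
  move=> cf; have [M [Mr hM]] :=
    compact_bounded (continuous_compact (continuous_subspaceT cf) cX).
  exists (`|M| + 1); first by rewrite ltr_wpDl.
  by move=> x; apply: hM; [rewrite ltr_pwDr ?ler_norm|exists x].
have LE (g : X -> R) : continuous g -> (forall x, 0 <= g x <= 1) ->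
    (fun i => \int[nu i]_x g x) @ G --> L g.
  by move=> cg g01; apply: (cvg_ultra_bounded UG) => i; exact: Rintegral_unit_itv.
have half (g : X -> R) : continuous g -> (forall x, 0 <= g x <= 1) ->
    \int[mu]_x g x <= L g.
  move=> cg g01; apply/ler_addgt0Pr => e e0.
  have [N _ /(_ N (leqnn N)) /= Ne] := @near_infty_natSinv_lt R (PosNum e0).
  have oU k : open [set x | k.+1%:R < N.+1%:R * g x].
    rewrite (_ : [set _ | _] = (fun x => N.+1%:R * g x) @^-1` [set y | k.+1%:R < y])//.
    apply: open_comp; last exact: open_gt.
    by move=> x _; apply: cvgMr; exact: cg.
  have /andP[_ ub] := Rintegral_step_bounds mu N cg g01.
  apply: (le_trans ub); rewrite addrC; apply: lerD; last exact: ltW.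
  pose S := N.+1%:R^-1 * \sum_(k < N.+1) pi [set x | k.+1%:R < N.+1%:R * g x].
  apply: (@le_trans _ _ S).
    by apply: ler_wpM2l => //; apply: ler_sum => k _; exact: mu_le.
  apply: (@ler_cvg_to _ _ _ _ (fun i => step_sum (nu i) g N) _ _ _ _ (LE _ cg g01)).
    apply: cvgMr.
    apply: (cvg_sum_seq (f := fun (k : 'I_N.+1) i =>
      fine (nu i [set x | k.+1%:R < N.+1%:R * g x]))) => k.
    by apply: piE; exact: mO.
  apply: filterE => i; by have /andP[] := Rintegral_step_bounds (nu i) N cg g01.
have key (g : X -> R) : continuous g -> (forall x, 0 <= g x <= 1) ->
    (fun i => \int[nu i]_x g x) @ G --> \int[mu]_x g x.
  move=> cg g01; have cg' : continuous (fun x => 1 + -1 * g x).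
    by move=> x; apply: cvgD; [exact: cvg_cst|apply: cvgMr; exact: cg].
  have g01' x : 0 <= 1 + -1 * g x <= 1 by have := g01 x; lra.
  suff -> : \int[mu]_x g x = L g by exact: LE.
  apply/eqP; rewrite eq_le half//=.
  have := half _ cg' g01'; rewrite Rintegral_affine//.
  suff -> : L (fun x => 1 + -1 * g x) = 1 + -1 * L g by lra.
  apply/cvg_lim => //.
  rewrite (_ : (fun i => _) = fun i => 1 + -1 * \int[nu i]_x g x).
    by apply: cvgD; [exact: cvg_cst|apply: cvgMr; exact: LE].
  by apply/funext => i; rewrite Rintegral_affine.
exists mu; split => [f cf|T cT Tnu].
  have [M M0 fM] := bdd f cf.
  pose g x := 1 / 2 + (2 * M)^-1 * f x.
  have cg : continuous g.
    by move=> x; apply: cvgD; [exact: cvg_cst|apply: cvgMr; exact: cf].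
  have g01 x : 0 <= g x <= 1.
    rewrite /g; have := fM x; rewrite ler_norml => /andP[f1 f2].
    have : -1 / 2 <= (2 * M)^-1 * f x <= 1 / 2.
      rewrite ler_pdivlMl ?ler_pdivrMl ?mulr_gt0//; lra.
    lra.
  have fE : f = fun x => - M + 2 * M * g x.
    by apply/funext => x; rewrite /g; field; rewrite gt_eqF.
  rewrite fE Rintegral_affine//.
  rewrite (_ : (fun i => _) = fun i => - M + 2 * M * \int[nu i]_x g x).
    by apply: cvgD; [exact: cvg_cst|apply: cvgMr; exact: key].
  by apply/funext => i; rewrite Rintegral_affine.
have [mu' mu'E] := continuous_pushforward mu cT.
suff eqmu : measure_eq mu mu' by move=> A mA; rewrite -mu'E eqmu.
apply: measure_eq_open_le => U oU; rewrite mu'E.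
have /continuousP cT' := cT.
rewrite (muE _ oU) (muE _ (cT' _ oU)); apply/ereal_supP => _ [C [cC CU] <-].
have -> : pi C = pi (T @^-1` C).
  rewrite /pi; congr (lim (_ @ G)); apply/funext => i.
  by rewrite Tnu//; exact: mC.
apply: inner_content_ge => [|x]; last exact: CU.
by apply: closed_comp cC => x _; exact: cT.
Qed.

End weak_limit.

(** * Shannon entropy *)

Section shannon.
Context {R : realType}.
Implicit Types x y t : R.

Definition xlnx x := - (x * ln x).

Lemma xlnx0 : xlnx 0 = 0. Proof. by rewrite /xlnx mul0r oppr0. Qed.

Lemma xlnx_ge0 x : 0 <= x <= 1 -> 0 <= xlnx x.
Proof. by move=> /andP[x0 x1]; rewrite /xlnx -mulrN mulr_ge0// oppr_ge0 ln_le0. Qed.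

(* Tangent line of the logarithm: both the concavity and the subadditivity of
   the entropy are instances. *)
Lemma mul_ln_ratio_le x y : 0 <= x -> 0 <= y -> (0 < x -> 0 < y) ->
  x * (ln y - ln x) <= y - x.
Proof.
rewrite le_eqVlt => /predU1P[<-|x0] y0 xy; first by rewrite mul0r subr0.
have {}y0 := xy x0.
have yx0 : 0 < y / x by rewrite divr_gt0.
have := @le_ln1Dx R (y / x - 1); rewrite (addrC 1) subrK => /(_ _) lnyx.
rewrite -ln_div ?posrE//; apply: (@le_trans _ _ (x * (y / x - 1))).
  by rewrite ler_wpM2l ?(ltW x0)// lnyx//; lra.
by rewrite mulrBr mulrC divfK ?gt_eqF// mulr1.
Qed.

Lemma xlnx_concave t x y : 0 <= t <= 1 -> 0 <= x -> 0 <= y ->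
  t * xlnx x + (1 - t) * xlnx y <= xlnx (t * x + (1 - t) * y).
Proof.
move=> /andP[t0 t1] x0 y0; set m := _ + _ * y.
have t1' : 0 <= 1 - t by rewrite subr_ge0.
have m0 : 0 <= m by rewrite addr_ge0 ?mulr_ge0.
have hx : t * (x * (ln m - ln x)) <= t * (m - x).
  move: t0; rewrite le_eqVlt => /predU1P[<-|t0]; first by rewrite !mul0r.
  rewrite ler_wpM2l ?(ltW t0)// mul_ln_ratio_le// => x0'.
  by rewrite /m ltr_pwDl ?mulr_gt0// mulr_ge0.
have hy : (1 - t) * (y * (ln m - ln y)) <= (1 - t) * (m - y).
  move: t1'; rewrite le_eqVlt => /predU1P[<-|t1']; first by rewrite !mul0r.
  rewrite ler_wpM2l ?(ltW t1')// mul_ln_ratio_le// => y0'.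
  by rewrite /m ltr_wpDl ?mulr_gt0// mulr_ge0.
have : t * (m - x) + (1 - t) * (m - y) = 0 by rewrite /m; ring.
have mE : m * ln m = t * x * ln m + (1 - t) * y * ln m by rewrite /m; ring.
rewrite /xlnx mE; lra.
Qed.

Lemma xlnxD_le x y : 0 <= x -> 0 <= y -> xlnx (x + y) <= xlnx x + xlnx y.
Proof.
rewrite le_eqVlt => /predU1P[<- _|x0]; first by rewrite add0r xlnx0 add0r.
rewrite le_eqVlt => /predU1P[<-|y0]; first by rewrite addr0 xlnx0 addr0.
rewrite /xlnx mulrDl opprD lerD// lerN2.
  rewrite ler_wpM2l ?(ltW x0)//; by rewrite ler_ln ?posrE ?addr_gt0// lerDl ltW.
rewrite ler_wpM2l ?(ltW y0)//; by rewrite ler_ln ?posrE ?addr_gt0// lerDr ltW.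
Qed.

Lemma xlnxM t x : 0 <= t -> 0 <= x -> xlnx (t * x) = t * xlnx x + x * xlnx t.
Proof.
rewrite le_eqVlt => /predU1P[<- _|t0]; first by rewrite !mul0r xlnx0 mulr0 addr0.
rewrite le_eqVlt => /predU1P[<-|x0]; first by rewrite !(mulr0, xlnx0) mul0r addr0.
by rewrite /xlnx lnM ?posrE//; ring.
Qed.

Lemma xlnx_mix_le t x y : 0 <= t <= 1 -> 0 <= x -> 0 <= y ->
  xlnx (t * x + (1 - t) * y) <=
  t * xlnx x + (1 - t) * xlnx y + (x * xlnx t + y * xlnx (1 - t)).
Proof.
move=> /andP[t0 t1] x0 y0; have t1' : 0 <= 1 - t by rewrite subr_ge0.
rewrite (le_trans (xlnxD_le _ _)) ?mulr_ge0// !xlnxM//; lra.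
Qed.

Section pushforward.
Context {W : finType} (p : W -> R) (p0 : forall w, 0 <= p w).

Definition push {V : finType} (f : W -> V) (v : V) := \sum_(w | f w == v) p w.

Lemma push_ge {V : finType} (f : W -> V) w : p w <= push f (f w).
Proof. by rewrite /push (bigD1 w)//= lerDl sumr_ge0. Qed.

Lemma push_ge0 {V : finType} (f : W -> V) v : 0 <= push f v.
Proof. exact: sumr_ge0. Qed.

Lemma sum_push {V : finType} (f : W -> V) (g : V -> R) :
  \sum_v push f v * g v = \sum_w p w * g (f w).
Proof.
rewrite [RHS](partition_big f xpredT)//=; apply: eq_bigr => v _.
by rewrite /push mulr_suml; apply: eq_bigr => w /eqP ->.
Qed.

Lemma shannon_push_le {V : finType} (f : W -> V) :
  \sum_v xlnx (push f v) <= \sum_w xlnx (p w).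
Proof.
rewrite /xlnx !sumrN lerN2 (sum_push f (fun v => ln (push f v))).
apply: ler_sum => w _; have := p0 w.
rewrite le_eqVlt => /predU1P[<-|pw]; first by rewrite !mul0r.
rewrite ler_wpM2l ?(ltW pw)// ler_ln ?posrE ?push_ge//.
by rewrite (lt_le_trans pw)// push_ge.
Qed.

Lemma shannon_subadditive {V1 V2 : finType} (f : W -> V1) (g : W -> V2) :
    \sum_w p w = 1 -> injective (fun w => (f w, g w)) ->
  \sum_w xlnx (p w) <= \sum_v xlnx (push f v) + \sum_v xlnx (push g v).
Proof.
move=> p1 fg; rewrite /xlnx !sumrN (sum_push f (fun v => ln (push f v))).
rewrite (sum_push g (fun v => ln (push g v))) -opprD lerN2 -big_split/=.
rewrite -subr_le0 -sumrB.
have pos w : 0 < p w -> 0 < push f (f w) * push g (g w).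
  by move=> pw; rewrite mulr_gt0// (lt_le_trans pw)// push_ge.
apply: (@le_trans _ _ (\sum_w (push f (f w) * push g (g w) - p w))).
  apply: ler_sum => w _.
  apply: le_trans (mul_ln_ratio_le (p0 w) _ (pos w)); last first.
    by rewrite mulr_ge0// push_ge0.
  have := p0 w; rewrite le_eqVlt => /predU1P[<-|pw]; first by rewrite !mul0r addr0 subr0.
  rewrite lnM ?posrE ?(lt_le_trans pw) ?push_ge//; lra.
rewrite sumrB p1 subr_le0.
have sum1 (V : finType) (h : W -> V) : \sum_v push h v = 1.
  by rewrite -p1 [RHS](partition_big h xpredT).
rewrite -[leRHS]mulr1 -{1}(sum1 _ f) -(sum1 _ g) big_distrlr/= pair_bigA/=.
rewrite -(big_imset (fun vu => push f vu.1 * push g vu.2) (in2W fg))/=.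
rewrite [leRHS](bigID [in [set (f w, g w) | w in W]%SET])/= lerDl.
by apply: sumr_ge0 => vu _; rewrite mulr_ge0// push_ge0.
Qed.

End pushforward.
End shannon.

Lemma fekete (R : realType) (u : R^nat) :
    (forall n, 0 <= u n) -> (forall m n, u (m + n)%N <= u m + u n) ->
  cvgn (fun n => n%:R^-1 * u n).
Proof.
move=> u0 uD.
pose E := [set n.+1%:R^-1 * u n.+1 | n in [set: nat]].
have infE : has_inf E.
  split; first by exists (1%:R^-1 * u 1%N), 0%N.
  by exists 0 => _ [n _ <-]; rewrite mulr_ge0.
have uM m q : u (q * m)%N <= q%:R * u m + u 0%N.
  elim: q => [|q IH]; first by rewrite mul0n mul0r add0r.
  by rewrite mulSn (le_trans (uD _ _))// -natr1 mulrDl mul1r; lra.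
have u1 r : u r <= r%:R * u 1%N + u 0%N by have := uM 1%N r; rewrite muln1.
apply/cvg_ex; exists (inf E); apply/cvgrPdist_le => e e0.
have e20 : 0 < e / 2 by rewrite divr_gt0.
have [_ [m _ <-] ltm] := inf_adherent e20 infE.
pose K := m.+1%:R * u 1%N + 2 * u 0%N.
have K0 : 0 <= K by rewrite addr_ge0 ?mulr_ge0.
have [N _ HN] : \forall n \near \oo, K / (e / 2) <= n%:R :> R by exact: nbhs_infty_ger.
near=> n.
have n0 : (0 < n)%N by near: n; exact: nbhs_infty_gt.
have nK : K / (e / 2) <= n%:R by apply: HN; near: n; exact: nbhs_infty_ge.
have nR0 : 0 < n%:R :> R by rewrite ltr0n.
have lb : inf E <= n%:R^-1 * u n.
  by apply: ge_inf; [exact: infE.2|exists n.-1 => //; rewrite prednK].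
rewrite ler_distlC; apply/andP; split; first by lra.
rewrite ler_pdivrMl//.
have m0 : 0 < m.+1%:R :> R by [].
have um : u m.+1 <= (inf E + e / 2) * m.+1%:R by rewrite mulrC -ler_pdivrMl// ltW.
have un : u n <= (n %/ m.+1)%:R * u m.+1 + K.
  rewrite {1}(divn_eq n m.+1) (le_trans (uD _ _))//.
  have := uM m.+1 (n %/ m.+1)%N; have := u1 (n %% m.+1)%N.
  have : (n %% m.+1)%:R * u 1%N <= m.+1%:R * u 1%N.
    by rewrite ler_wpM2r// ler_nat ltnW// ltn_mod.
  by rewrite /K; lra.
have nm : (n %/ m.+1)%:R * m.+1%:R <= n%:R :> R.
  by rewrite -natrM ler_nat leq_trunc_div.
have inf0 : 0 <= inf E.
  by apply: lb_le_inf; [exact: infE.1|move=> _ [k _ <-]; rewrite mulr_ge0].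
have h1 : (n %/ m.+1)%:R * u m.+1 <= (inf E + e / 2) * n%:R.
  apply: (@le_trans _ _ ((n %/ m.+1)%:R * ((inf E + e / 2) * m.+1%:R))).
    by rewrite ler_wpM2l.
  by rewrite mulrCA ler_wpM2l// addr_ge0// ltW.
have h2 : K <= e / 2 * n%:R by rewrite -ler_pdivrMl ?divr_gt0// mulrC.
apply: (le_trans un); lra.
Unshelve. all: by end_near. Qed.

Section code_entropy.
Context d (Om : measurableType d) (R : realType).
Implicit Types mu nu rho : probability Om R.

(* A finite measurable partition is encoded by the function [c] sending a point to
   the index of its cell; joins of partitions are then pairs of codes. *)
Definition measurable_code {W : finType} (c : Om -> W) :=
  forall w, measurable (c @^-1` [set w]).

Definition code_dist mu {W : finType} (c : Om -> W) (w : W) : R :=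
  fine (mu (c @^-1` [set w])).

Definition code_entropy mu {W : finType} (c : Om -> W) : R :=
  \sum_w xlnx (code_dist mu c w).

Lemma code_dist_ge0 mu {W : finType} (c : Om -> W) w : 0 <= code_dist mu c w.
Proof. exact: fine_ge0. Qed.

Lemma code_preimage mu {W : finType} (c : Om -> W) (P : pred W) :
    measurable_code c ->
  measurable [set x | P (c x)] /\
  fine (mu [set x | P (c x)]) = \sum_(w | P w) code_dist mu c w.
Proof.
move=> mc.
suff H s : uniq s -> measurable [set x | (c x \in s) && P (c x)] /\
    fine (mu [set x | (c x \in s) && P (c x)]) =
    \sum_(w <- s | P w) code_dist mu c w.
  have [] := H (index_enum W) (index_enum_uniq _).
  by rewrite (_ : [set x | _] = [set x | P (c x)])//; apply/seteqP;
    split => x /=; rewrite mem_index_enum.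
elim: s => [_|w s IH /= /andP[ws us]].
  rewrite big_nil (_ : [set x | _] = set0) ?measure0//.
  by apply/seteqP; split.
have [mS SE] := IH us; rewrite big_cons; case: ifP => Pw.
  rewrite (_ : [set x | _] =
    (c @^-1` [set w]) `|` [set x | (c x \in s) && P (c x)]); last first.
    apply/seteqP; split => x /=.
      by rewrite inE => /andP[/orP[/eqP|] ? ?]; [left|right; apply/andP].
    by move=> [->|/andP[xs Px]]; rewrite inE ?eqxx// xs Px orbT.
  split; first exact: measurableU.
  rewrite measureU//; last first.
    by apply/seteqP; split => x //= [xw]; rewrite xw (negbTE ws).
  by rewrite fineD ?fin_num_measure// SE.
rewrite (_ : [set x | _] = [set x | (c x \in s) && P (c x)])//.
apply/seteqP; split => x /=; rewrite inE.
  by move=> /andP[/orP[/eqP ->|->]//]; rewrite Pw.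
by move=> /andP[-> ->]; rewrite orbT.
Qed.

Lemma measurable_code_comp {W V : finType} (c : Om -> W) (f : W -> V) :
  measurable_code c -> measurable_code (f \o c).
Proof.
move=> mc v; rewrite (_ : _ @^-1` _ =
  \bigcup_(w in [set w | f w = v]) (c @^-1` [set w])).
  by apply: fin_bigcup_measurable => // w _; exact: mc.
by apply/seteqP; split => [x fx|x [w /= <- ->]//]; exists (c x).
Qed.

Lemma code_dist_comp mu {W V : finType} (c : Om -> W) (f : W -> V) v :
  measurable_code c -> code_dist mu (f \o c) v = push (code_dist mu c) f v.
Proof.
move=> mc; rewrite /code_dist (_ : _ @^-1` _ = [set x | f (c x) == v]).
  by have [] := code_preimage mu [pred w | f w == v] mc.
by apply/seteqP; split => x /= /eqP.
Qed.

Lemma sum_code_dist mu {W : finType} (c : Om -> W) : measurable_code c ->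
  \sum_w code_dist mu c w = 1.
Proof.
move=> mc; have [_ <-] := code_preimage mu xpredT mc.
by rewrite (_ : [set x | _] = setT) ?probability_setT//; apply/seteqP; split.
Qed.

Lemma code_dist_le1 mu {W : finType} (c : Om -> W) w : measurable_code c ->
  code_dist mu c w <= 1.
Proof.
by move=> mc; rewrite -lee_fin fineK ?fin_num_measure// probability_le1.
Qed.

Lemma code_entropy_ge0 mu {W : finType} (c : Om -> W) : measurable_code c ->
  0 <= code_entropy mu c.
Proof.
by move=> mc; apply: sumr_ge0 => w _; rewrite xlnx_ge0// code_dist_ge0 code_dist_le1.
Qed.

Lemma code_entropy_comp_le mu {W V : finType} (c : Om -> W) (f : W -> V) :
  measurable_code c -> code_entropy mu (f \o c) <= code_entropy mu c.
Proof.
move=> mc; apply: le_trans (shannon_push_le (code_dist_ge0 mu c) f).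
by apply: ler_sum => v _; rewrite code_dist_comp.
Qed.

Lemma code_entropy_subadditive mu {W V1 V2 : finType} (c : Om -> W)
    (f : W -> V1) (g : W -> V2) :
    measurable_code c -> injective (fun w => (f w, g w)) ->
  code_entropy mu c <= code_entropy mu (f \o c) + code_entropy mu (g \o c).
Proof.
move=> mc fg.
apply: le_trans (shannon_subadditive (code_dist_ge0 mu c) (sum_code_dist mu mc) fg) _.
by rewrite lerD// ler_sum// => v _; rewrite code_dist_comp.
Qed.

Definition mixture (t : R) mu nu rho := forall A, measurable A ->
  fine (rho A) = t * fine (mu A) + (1 - t) * fine (nu A).

Lemma code_entropy_mixture_ge (t : R) mu nu rho {W : finType} (c : Om -> W) :
    0 <= t <= 1 -> mixture t mu nu rho -> measurable_code c ->
  t * code_entropy mu c + (1 - t) * code_entropy nu c <= code_entropy rho c.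
Proof.
move=> t01 mix mc; rewrite /code_entropy !mulr_sumr -big_split/=.
apply: ler_sum => w _; rewrite /code_dist (mix _ (mc w)).
by apply: xlnx_concave; rewrite ?fine_ge0.
Qed.

Lemma code_entropy_mixture_le (t : R) mu nu rho {W : finType} (c : Om -> W) :
    0 <= t <= 1 -> mixture t mu nu rho -> measurable_code c ->
  code_entropy rho c <= t * code_entropy mu c + (1 - t) * code_entropy nu c +
    (xlnx t + xlnx (1 - t)).
Proof.
move=> t01 mix mc.
have sumE m a : a = \sum_w code_dist m c w * a.
  by rewrite -mulr_suml sum_code_dist// mul1r.
rewrite [X in _ + (X + _)](sumE mu) [X in _ + (_ + X)](sumE nu).
rewrite /code_entropy !mulr_sumr -!big_split/=.
apply: ler_sum => w _; rewrite /code_dist (mix _ (mc w)).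
by apply: xlnx_mix_le; rewrite ?fine_ge0.
Qed.

End code_entropy.

(** * Kolmogorov-Sinai entropy *)

Section ks_entropy_theory.
Context (R : realType) (X : pmetricType R) (T : X -> X) (cT : continuous T).
Implicit Types mu nu rho : probability (borel X) R.

Definition itinerary {W : finType} (c : borel X -> W) (n : nat) (x : borel X) :
  {ffun 'I_n -> W} := [ffun j : 'I_n => c (iter j T x)].

Lemma measurable_iter n (A : set (borel X)) :
  measurable A -> measurable ((iter n T : borel X -> borel X) @^-1` A).
Proof.
have mT := continuous_measurable_map cT.
elim: n A => [//|n IH] A mA.
rewrite (_ : _ @^-1` A = (iter n T) @^-1` ((T : borel X -> borel X) @^-1` A))//.
by apply: IH; rewrite -[X in measurable X]setTI; exact: mT.
Qed.

Lemma measurable_code_itinerary {W : finType} (c : borel X -> W) n :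
  measurable_code c -> measurable_code (itinerary c n).
Proof.
move=> mc w; rewrite (_ : _ @^-1` _ =
    \bigcap_(j in [set: 'I_n]) ((iter j T : borel X -> borel X) @^-1` (c @^-1` [set w j]))).
  by apply: fin_bigcap_measurable => [//|j _]; apply: measurable_iter; exact: mc.
apply/seteqP; split => x /=.
  by move=> <- j _ /=; rewrite ffunE.
by move=> xw; apply/ffunP => j; rewrite ffunE; exact: xw.
Qed.

Lemma invariant_iter mu n (A : set (borel X)) : invariant_measures T mu ->
  measurable A -> mu ((iter n T : borel X -> borel X) @^-1` A) = mu A.
Proof.
move=> Tmu; elim: n A => [//|n IH] A mA.
rewrite (_ : _ @^-1` A = (T : borel X -> borel X) @^-1` ((iter n T) @^-1` A)).
  by rewrite Tmu ?IH//; exact: measurable_iter.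
by apply/seteqP; split => x /=; rewrite -iterS iterSr.
Qed.

Lemma itinerary_entropyD mu {W : finType} (c : borel X -> W) m n :
    invariant_measures T mu -> measurable_code c ->
  code_entropy mu (itinerary c (m + n)) <=
  code_entropy mu (itinerary c m) + code_entropy mu (itinerary c n).
Proof.
move=> Tmu mc.
pose f (w : {ffun 'I_(m + n) -> W}) : {ffun 'I_m -> W} := [ffun j => w (lshift n j)].
pose g (w : {ffun 'I_(m + n) -> W}) : {ffun 'I_n -> W} := [ffun j => w (rshift m j)].
have fg : injective (fun w => (f w, g w)).
  move=> w w' [/ffunP fw /ffunP gw]; apply/ffunP => j.
  case: (splitP j) => i ji.
    by have := fw i; rewrite !ffunE (_ : lshift n i = j)//; exact/val_inj.
  by have := gw i; rewrite !ffunE (_ : rshift m i = j)//; exact/val_inj.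
have mi := measurable_code_itinerary (n := (m + n)%N) mc.
apply: le_trans (code_entropy_subadditive mu mi fg) _.
apply: lerD.
  rewrite (_ : f \o _ = itinerary c m)//.
  by apply/funext => x; apply/ffunP => j; rewrite /= !ffunE.
rewrite (_ : g \o _ = itinerary c n \o iter m T).
  apply: ler_sum => w _; rewrite /code_dist.
  rewrite -(invariant_iter m Tmu (measurable_code_itinerary (n := n) mc w)).
  exact: lexx.
apply/funext => x; apply/ffunP => j; rewrite /= !ffunE/=.
by rewrite addnC iterD.
Qed.

Definition entropy_rate mu {W : finType} (c : borel X -> W) : R :=
  limn (fun n => n%:R^-1 * code_entropy mu (itinerary c n)).

Lemma cvg_entropy_rate mu {W : finType} (c : borel X -> W) :
    invariant_measures T mu -> measurable_code c ->
  (fun n => n%:R^-1 * code_entropy mu (itinerary c n)) @ \oo --> entropy_rate mu c.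
Proof.
move=> Tmu mc; apply: fekete => [n|m n].
  by apply: code_entropy_ge0; exact: measurable_code_itinerary.
exact: itinerary_entropyD.
Qed.

Lemma entropy_rate_ge0 mu {W : finType} (c : borel X -> W) :
  invariant_measures T mu -> measurable_code c -> 0 <= entropy_rate mu c.
Proof.
move=> Tmu mc; apply: (ler_cvg_to (@cvg_cst _ 0 _ _ _) (cvg_entropy_rate Tmu mc)).
apply: nearW => n; rewrite mulr_ge0//.
by apply: code_entropy_ge0; exact: measurable_code_itinerary.
Qed.

Lemma entropy_rate_comp_le mu {W V : finType} (c : borel X -> W) (f : W -> V) :
    invariant_measures T mu -> measurable_code c ->
  entropy_rate mu (f \o c) <= entropy_rate mu c.
Proof.
move=> Tmu mc.
have mfc := measurable_code_comp f mc.
apply: (ler_cvg_to (cvg_entropy_rate Tmu mfc) (cvg_entropy_rate Tmu mc)).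
apply: nearW => n; rewrite ler_wpM2l//.
pose F (w : {ffun 'I_n -> W}) : {ffun 'I_n -> V} := [ffun j => f (w j)].
rewrite (_ : itinerary (f \o c) n = F \o itinerary c n).
  by apply: code_entropy_comp_le; exact: measurable_code_itinerary.
by apply/funext => x; apply/ffunP => j; rewrite /= !ffunE.
Qed.

Lemma entropy_rate_mixture_ge t mu nu rho {W : finType} (c : borel X -> W) :
    invariant_measures T mu -> invariant_measures T nu ->
    invariant_measures T rho -> measurable_code c ->
    0 <= t <= 1 -> mixture t mu nu rho ->
  t * entropy_rate mu c + (1 - t) * entropy_rate nu c <= entropy_rate rho c.
Proof.
move=> Tmu Tnu Trho mc t01 mix.
have cmu := cvg_entropy_rate Tmu mc; have cnu := cvg_entropy_rate Tnu mc.
apply: (ler_cvg_to (cvgD (cvgMr cmu) (cvgMr cnu)) (cvg_entropy_rate Trho mc)).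
apply: nearW => n /=; rewrite !fctE/=.
have := code_entropy_mixture_ge t01 mix (measurable_code_itinerary (n := n) mc).
have : 0 <= n%:R^-1 :> R by [].
move=> n0 /(ler_wpM2l n0); lra.
Qed.

Lemma entropy_rate_mixture_le t mu nu rho {W : finType} (c : borel X -> W) :
    invariant_measures T mu -> invariant_measures T nu ->
    invariant_measures T rho -> measurable_code c ->
    0 <= t <= 1 -> mixture t mu nu rho ->
  entropy_rate rho c <= t * entropy_rate mu c + (1 - t) * entropy_rate nu c.
Proof.
move=> Tmu Tnu Trho mc t01 mix.
have cmu := cvg_entropy_rate Tmu mc; have cnu := cvg_entropy_rate Tnu mc.
have inv0 : (fun n => n%:R^-1 * (xlnx t + xlnx (1 - t))) @ \oo --> (0 : R).
  rewrite -[X in _ --> X](mul0r (xlnx t + xlnx (1 - t))); apply: cvgMl.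
  apply/gtr0_cvgV0; last exact: cvgr_idn.
  by near=> n; rewrite ltr0n; near: n; exact: nbhs_infty_gt.
rewrite -[leRHS]addr0.
apply: (ler_cvg_to (cvg_entropy_rate Trho mc) (cvgD (cvgD (cvgMr cmu) (cvgMr cnu)) inv0)).
apply: nearW => n /=; rewrite !fctE/=.
have := code_entropy_mixture_le t01 mix (measurable_code_itinerary (n := n) mc).
have : 0 <= n%:R^-1 :> R by [].
move=> n0 /(ler_wpM2l n0); lra.
Unshelve. all: by end_near. Qed.

Lemma measurable_partition_code k (xi : 'I_k -> set (borel X)) :
    measurable_partition xi ->
  exists c : borel X -> 'I_k, forall i, xi i = c @^-1` [set i].
Proof.
move=> [mxi txi covxi].
have /choice[c cP] (x : borel X) : exists i, xi i x.
  by have : [set: borel X] x by []; rewrite -covxi => -[i _ xix]; exists i.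
exists c => i; apply/seteqP; split => [x xix|x /= <-//].
by rewrite /=; apply: (txi) => //; exists x; split.
Qed.

Lemma partition_entropy_rate mu k (xi : 'I_k -> set (borel X)) c :
  (forall i, xi i = c @^-1` [set i]) ->
  partition_entropy T mu xi = entropy_rate mu c.
Proof.
move=> xiE; congr (limn _); apply/funext => n; congr (_ * _).
apply: eq_bigr => w _; rewrite /xlnx /code_dist.
rewrite (_ : join_cell T xi w = itinerary c n @^-1` [set w])//.
apply/seteqP; split => x /=.
  by move=> xw; apply/ffunP => j; rewrite ffunE; have := xw j; rewrite xiE.
by move=> <- j; rewrite xiE/= ffunE.
Qed.

Lemma ge_ks_entropy mu {W : finType} (c : borel X -> W) :
  invariant_measures T mu -> measurable_code c ->
  ((entropy_rate mu c)%:E <= ks_entropy T mu)%E.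
Proof.
move=> Tmu mc; pose c' := enum_rank \o c.
have mc' : measurable_code c' by exact: measurable_code_comp.
have cE : c = enum_val \o c' by apply/funext => x; rewrite /= enum_rankK.
apply: (@le_trans _ _ (entropy_rate mu c')%:E).
  by rewrite lee_fin {1}cE; exact: entropy_rate_comp_le.
apply: ereal_sup_ubound; exists #|W|, (fun i => c' @^-1` [set i]); split.
  split => //.
    by move=> i j _ _ [x [/= <- <-]].
  by apply/seteqP; split => // x _; exists (c' x).
by congr (_%:E); apply/esym/partition_entropy_rate.
Qed.

Lemma ks_entropy_le mu (M : \bar R) :
    (forall k (c : borel X -> 'I_k), measurable_code c ->
      ((entropy_rate mu c)%:E <= M)%E) ->
  (ks_entropy T mu <= M)%E.
Proof.
move=> H; apply/ereal_supP => _ [k [xi [pxi ->]]].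
have [c cE] := measurable_partition_code pxi.
rewrite (partition_entropy_rate mu cE); apply: H => i.
by rewrite -cE; case: pxi.
Qed.

Lemma ks_entropy_ge0 mu : invariant_measures T mu -> (0 <= ks_entropy T mu)%E.
Proof.
move=> Tmu.
have mc : measurable_code (fun _ : borel X => tt).
  by move=> []; rewrite (_ : _ @^-1` _ = setT)//; apply/seteqP; split.
by apply: le_trans (ge_ks_entropy Tmu mc); rewrite lee_fin entropy_rate_ge0.
Qed.

Lemma ks_entropy_mixture_ge t mu nu rho :
    invariant_measures T mu -> invariant_measures T nu ->
    invariant_measures T rho ->
    0 < t < 1 -> mixture t mu nu rho ->
  (t%:E * ks_entropy T mu + (1 - t)%:E * ks_entropy T nu <= ks_entropy T rho)%E.
Proof.
move=> Tmu Tnu Trho /andP[t0 t1] mix.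
have t1' : 0 < 1 - t by rewrite subr_gt0.
have t01 : 0 <= t <= 1 by rewrite !ltW.
have ks0 := ks_entropy_ge0 Trho.
have [->|rhofin] := eqVneq (ks_entropy T rho) +oo%E; first by rewrite leey.
have {}rhofin : ks_entropy T rho \is a fin_num by rewrite ge0_fin_numE// ltey.
set r := fine (ks_entropy T rho).
have rE : ks_entropy T rho = r%:E by rewrite fineK.
have key k l (c : borel X -> 'I_k) (c' : borel X -> 'I_l) :
    measurable_code c -> measurable_code c' ->
    t * entropy_rate mu c + (1 - t) * entropy_rate nu c' <= r.
  move=> mc mc'; pose cc x := (c x, c' x).
  have mcc : measurable_code cc.
    move=> [i j]; rewrite (_ : _ @^-1` _ = c @^-1` [set i] `&` c' @^-1` [set j]).
      exact: measurableI.
    by apply/seteqP; split => x; rewrite /cc/= => -[-> ->].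
  rewrite -lee_fin -rE; apply: le_trans (ge_ks_entropy Trho mcc).
  rewrite lee_fin (le_trans _ (entropy_rate_mixture_ge Tmu Tnu Trho mcc t01 mix))//.
  have h1 := @entropy_rate_comp_le mu _ _ cc fst Tmu mcc.
  have h2 := @entropy_rate_comp_le nu _ _ cc snd Tnu mcc.
  by rewrite lerD// ler_pM2l.
have mc0 : measurable_code (fun _ : borel X => ord0 : 'I_1).
  move=> i; rewrite (_ : _ @^-1` _ = setT)//.
  by apply/seteqP; split => // x _; rewrite /= (ord1 i).
have fin_nu : ks_entropy T nu \is a fin_num.
  rewrite ge0_fin_numE ?ks_entropy_ge0//.
  apply: (@le_lt_trans _ _ (r / (1 - t))%:E); last by rewrite ltry.
  apply: ks_entropy_le => k c mc; rewrite lee_fin ler_pdivlMr// mulrC.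
  have := key _ _ _ _ mc0 mc; have := entropy_rate_ge0 Tmu mc0.
  by move=> /(mulr_ge0 (ltW t0)); lra.
have fin_mu : ks_entropy T mu \is a fin_num.
  rewrite ge0_fin_numE ?ks_entropy_ge0//.
  apply: (@le_lt_trans _ _ (r / t)%:E); last by rewrite ltry.
  apply: ks_entropy_le => k c mc; rewrite lee_fin ler_pdivlMr// mulrC.
  have := key _ _ _ _ mc mc0; have := entropy_rate_ge0 Tnu mc0.
  by move=> /(mulr_ge0 (ltW t1')); lra.
rewrite rE -(fineK fin_mu) -(fineK fin_nu) -!EFinM -EFinD lee_fin.
rewrite -lerBrDr -ler_pdivlMl// -lee_fin fineK//.
apply: ks_entropy_le => k c mc; rewrite lee_fin ler_pdivlMl// lerBrDr addrC -lerBrDr.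
rewrite -ler_pdivlMl// -lee_fin fineK//.
apply: ks_entropy_le => l c' mc'; rewrite lee_fin ler_pdivlMl// lerBrDr addrC.
exact: key.
Qed.

Lemma ks_entropy_mixture_le t mu nu rho :
    invariant_measures T mu -> invariant_measures T nu ->
    invariant_measures T rho ->
    0 < t < 1 -> mixture t mu nu rho ->
  (ks_entropy T rho <= t%:E * ks_entropy T mu + (1 - t)%:E * ks_entropy T nu)%E.
Proof.
move=> Tmu Tnu Trho /andP[t0 t1] mix.
have t1' : 0 < 1 - t by rewrite subr_gt0.
have t01 : 0 <= t <= 1 by rewrite !ltW.
apply: ks_entropy_le => k c mc.
apply: (@le_trans _ _ (t * entropy_rate mu c + (1 - t) * entropy_rate nu c)%:E).
  by rewrite lee_fin entropy_rate_mixture_le.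
rewrite EFinD !EFinM; apply: leeD; apply: lee_wpmul2l; try exact: ge_ks_entropy.
  by rewrite lee_fin ltW.
by rewrite lee_fin ltW.
Qed.

End ks_entropy_theory.

(** * Supergradients of concave functions *)

Section sublinear.
Context {R : realType} {V : lmodType R}.
Implicit Types (p : V -> R) (u v e : V).

Definition sublinear p :=
  (forall u v, p (u + v) <= p u + p v) /\
  (forall t v, 0 < t -> p (t *: v) = t * p v).

Lemma sublinear0 p : sublinear p -> p 0 = 0.
Proof. by move=> [_ /(_ 2 0)]; rewrite scaler0 => /(_ (ltr0Sn _ 1)) ?; lra. Qed.

Lemma sublinear_ge_line p e t : sublinear p -> t * p e <= p (t *: e).
Proof.
move=> sp; have [pD pZ] := sp.
have [t0|t0|->] := ltrgtP t 0; last by rewrite scale0r sublinear0// mul0r.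
- have nt0 : 0 < - t by rewrite oppr_gt0.
  have := pD (t *: e) (- t *: e); rewrite -scalerDl subrr scale0r sublinear0//.
  by rewrite (pZ _ _ nt0); lra.
- by rewrite pZ.
Qed.

(* The infimum of [p] along the direction [e] makes a sublinear functional
   affine in that direction: one step of the Hahn-Banach extension. *)
Lemma sublinear_flatten p e : sublinear p ->
  exists p', [/\ sublinear p', forall v, p' v <= p v,
    forall v t, p' (v + t *: e) = p' v + t * p e &
    forall u c, (forall v t, p (v + t *: u) = p v + t * c) ->
                forall v t, p' (v + t *: u) = p' v + t * c].
Proof.
move=> sp; have [pD pZ] := sp.
pose E v := [set p (v + t *: e) - t * p e | t in [set: R]].
pose p' v := inf (E v).
have lbE v : lbound (E v) (- p (- v)).
  move=> _ [t _ <-]; have := pD (v + t *: e) (- v); rewrite addrAC subrr add0r.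
  by have := sublinear_ge_line e t sp; lra.
have infE v : has_inf (E v).
  by split; [exists (p (v + 0 *: e) - 0 * p e), 0|exists (- p (- v))].
have p'_le v t : p' v <= p (v + t *: e) - t * p e.
  by apply: ge_inf; [exact: (infE v).2|exists t].
have p'_ge v a : (forall t, a <= p (v + t *: e) - t * p e) -> a <= p' v.
  by move=> H; apply: lb_le_inf; [exact: (infE v).1|move=> _ [t _ <-]].
have p'_shift u c : (forall v t, p (v + t *: u) = p v + t * c) ->
    forall v t, p' v + t * c <= p' (v + t *: u).
  move=> pu v t; apply: (p'_ge) => s; rewrite addrAC pu.
  by have := p'_le v s; lra.
have shift_eq u c : (forall v t, p' v + t * c <= p' (v + t *: u)) ->
    forall v t, p' (v + t *: u) = p' v + t * c.
  move=> H v t; apply/eqP; rewrite eq_le H andbT.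
  have := H (v + t *: u) (- t); rewrite -addrA -scalerDl subrr scale0r addr0.
  by lra.
exists p'; split.
- split=> [u v|t v t0].
    rewrite -lerBlDr; apply: (p'_ge) => s; rewrite lerBlDl -lerBlDr.
    apply: (p'_ge) => t; rewrite lerBlDr.
    apply: (le_trans (p'_le (u + v) (s + t))).
    have -> : u + v + (s + t) *: e = (u + s *: e) + (v + t *: e).
      by rewrite scalerDl addrACA.
    by have := pD (u + s *: e) (v + t *: e); lra.
  have le_scale w r : 0 < r -> r * p' w <= p' (r *: w).
    move=> r0; apply: (p'_ge) => s.
    have -> : r *: w + s *: e = r *: (w + (s / r) *: e).
      by rewrite scalerDr scalerA mulrCA divff ?mulr1// gt_eqF.
    rewrite pZ//; have := p'_le w (s / r).
    rewrite -(ler_pM2l r0) mulrBr mulrA mulrCA divff ?mulr1// gt_eqF//.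
  apply/eqP; rewrite eq_le le_scale// andbT -ler_pdivrMl//.
  have tV : 0 < t^-1 by rewrite invr_gt0.
  by have := le_scale (t *: v) _ tV; rewrite scalerA mulVf ?scale1r// gt_eqF.
- by move=> v; have := p'_le v 0; rewrite scale0r addr0 mul0r subr0.
- apply: shift_eq => v t; apply: (p'_ge) => s.
  by have := p'_le v (t + s); rewrite scalerDl addrA; lra.
- by move=> u c pu; apply: shift_eq; exact: p'_shift.
Qed.

End sublinear.

Lemma sublinear_ge_linear {R : realType} d (p : 'rV[R]_d -> R) : sublinear p ->
  exists q : 'rV[R]_d, forall v : 'rV[R]_d, \sum_(i < d) q 0 i * v 0 i <= p v.
Proof.
move=> sp.
have [p' [sp' p'p /choice[c cP]]] : exists p', [/\ sublinear p',
    forall v, p' v <= p v & forall i, exists c, i \in enum 'I_d ->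
      forall v t, p' (v + t *: delta_mx 0 i) = p' v + t * c].
  elim: (enum 'I_d) => [|i s [p1 [sp1 p1p p1s]]].
    by exists p; split => // i; exists 0.
  have [p2 [sp2 p2p1 p2i p2s]] := sublinear_flatten (delta_mx 0 i) sp1.
  exists p2; split => //; first by move=> v; apply: le_trans (p1p v).
  move=> j; have [->|ji] := eqVneq j i; first by exists (p1 (delta_mx 0 i)).
  have [c cP] := p1s j; exists c; rewrite inE (negbTE ji)/= => js.
  exact/p2s/cP.
exists (\row_i c i) => v; apply: le_trans (p'p v).
suff H (s : seq 'I_d) : p' (\sum_(i <- s) v 0 i *: delta_mx 0 i) =
    \sum_(i <- s) c i * v 0 i.
  by rewrite {2}[v]row_sum_delta H; apply: ler_sum => i _; rewrite mxE.
elim: s => [|i s IH]; first by rewrite !big_nil sublinear0.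
by rewrite !big_cons addrC cP ?mem_enum// IH addrC mulrC.
Qed.

Lemma interior_ray {R : realType} d (A : set 'rV[R]_d) z v :
  A° z -> exists2 s : R, 0 < s & A (z + s *: v).
Proof.
move=> Az.
have : (fun s : R => z + s *: v) @ (0 : R)^'+ --> z.
  rewrite -[X in _ --> X]addr0; apply: cvgD; first exact: cvg_cst.
  rewrite -[X in _ --> X](scale0r v); apply: cvgZr_tmp.
  exact: cvg_at_right_filter.
move=> /(_ _ Az) As.
near (0 : R)^'+ => s; exists s => //; near: s; exact: As.
Unshelve. all: by end_near. Qed.

Lemma concave_superdifferential {R : realType} d (A : set 'rV[R]_d)
    (g : 'rV[R]_d -> R) (z : 'rV[R]_d) :
    A° z ->
    (forall x y t, A x -> A y -> 0 < t < 1 ->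
      t * g x + (1 - t) * g y <= g (t *: x + (1 - t) *: y)) ->
    (forall x y t, A x -> A y -> 0 < t < 1 -> A (t *: x + (1 - t) *: y)) ->
  exists q : 'rV[R]_d, forall w, A w ->
    g w + \sum_(i < d) q 0 i * (w 0 i - z 0 i) <= g z.
Proof.
move=> zA gA cA.
(* [p v] is the directional derivative of [- g] at [z]; it is finite because [z]
   is interior. *)
pose E v := [set (g z - g (z + t *: v)) / t | t in [set t | 0 < t /\ A (z + t *: v)]].
pose p v := inf (E v).
have zz : A z by exact: interior_subset.
have comb t s (u v : 'rV[R]_d) : 0 < t -> 0 < s -> A (z + t *: u) -> A (z + s *: v) ->
    A (z + (t * s / (t + s)) *: (u + v)) /\
    s * g (z + t *: u) + t * g (z + s *: v) <=
    (t + s) * g (z + (t * s / (t + s)) *: (u + v)).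
  move=> t0 s0 Au Av; have ts0 : 0 < t + s by rewrite addr_gt0.
  have tsN0 : t + s != 0 by rewrite gt_eqF.
  have l01 : 0 < s / (t + s) < 1.
    by rewrite divr_gt0//= ltr_pdivrMr// mul1r ltrDr.
  have lE : 1 - s / (t + s) = t / (t + s).
    by rewrite -{1}(divff tsN0) -mulrBl addrK.
  have E1 : z + (t * s / (t + s)) *: (u + v) =
      (s / (t + s)) *: (z + t *: u) + (1 - s / (t + s)) *: (z + s *: v).
    rewrite scalerDr [X in _ = X + _]scalerDr [X in _ = _ + X]scalerDr.
    rewrite [RHS]addrACA -scalerDl (addrC (s / (t + s))) subrK scale1r lE !scalerA.
    by congr (_ + (_ *: _ + _ *: _)); field.
  rewrite E1; split; first exact: cA.
  have := gA _ _ _ Au Av l01; rewrite -(ler_pM2l ts0) lE.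
  suff -> : s * g (z + t *: u) + t * g (z + s *: v) = (t + s) *
     (s / (t + s) * g (z + t *: u) + t / (t + s) * g (z + s *: v)) by [].
  by field.
have lbE v : exists m, lbound (E v) m.
  have [s s0 As] := interior_ray (- v) zA.
  exists (- ((g z - g (z + s *: - v)) / s)) => _ [t [t0 At] <-].
  have [_] := comb _ _ _ _ t0 s0 At As.
  rewrite subrr scaler0 addr0 => H.
  rewrite -mulNr ler_pdivrMr// mulrAC ler_pdivlMr//; lra.
have infE v : has_inf (E v).
  split; last exact: lbE.
  by have [s s0 As] := interior_ray v zA; eexists; exists s.
have p_le v t : 0 < t -> A (z + t *: v) -> t * p v <= g z - g (z + t *: v).
  move=> t0 At; rewrite mulrC -ler_pdivlMr//.
  by apply: ge_inf; [exact: (infE v).2|exists t].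
have p_ge v a : (forall t, 0 < t -> A (z + t *: v) ->
      a <= (g z - g (z + t *: v)) / t) ->
    a <= p v.
  move=> H; apply: lb_le_inf; [exact: (infE v).1|move=> _ [t [t0 At] <-]].
  exact: H.
have sp : sublinear p.
  split=> [u v|r v r0].
    rewrite -lerBlDr; apply: (p_ge) => t t0 At.
    rewrite lerBlDl -lerBlDr; apply: (p_ge) => s s0 As.
    have [Ats Hts] := comb _ _ _ _ t0 s0 At As.
    have ts0 : 0 < t + s by rewrite addr_gt0.
    have tss0 : 0 < t * s / (t + s) by rewrite divr_gt0// mulr_gt0.
    have := p_le _ _ tss0 Ats; rewrite -(ler_pM2l ts0).
    have -> : (t + s) * (t * s / (t + s) * p (u + v)) = t * s * p (u + v).
      by field; rewrite gt_eqF.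
    set a := (g z - g (z + t *: u)) / t; set b := (g z - g (z + s *: v)) / s.
    have aE : g z - g (z + t *: u) = t * a by rewrite /a mulrC divfK// gt_eqF.
    have bE : g z - g (z + s *: v) = s * b by rewrite /b mulrC divfK// gt_eqF.
    move=> H; rewrite lerBlDr -(ler_pM2l (mulr_gt0 t0 s0)).
    have : s * (g z - g (z + t *: u)) + t * (g z - g (z + s *: v)) = t * s * (a + b).
      by rewrite aE bE; ring.
    lra.
  have le_scale w c : 0 < c -> c * p w <= p (c *: w).
    move=> c0; apply: (p_ge) => t t0; rewrite scalerA => At.
    rewrite ler_pdivlMr// (_ : c * p w * t = t * c * p w); last by ring.
    by apply: (p_le) => //; rewrite mulr_gt0.
  apply/eqP; rewrite eq_le le_scale// andbT -ler_pdivrMl//.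
  have rV : 0 < r^-1 by rewrite invr_gt0.
  by have := le_scale (r *: v) _ rV; rewrite scalerA mulVf ?scale1r// gt_eqF.
have [q qp] := sublinear_ge_linear sp.
exists q => w Aw; have := p_le (w - z) 1 ltr01.
rewrite scale1r subrKC mul1r => /(_ Aw); have := qp (w - z).
by under eq_bigr do rewrite !mxE; lra.
Qed.

(** * Mixtures and conditional measures *)

Lemma mixture_exists d (Om : measurableType d) (R : realType)
    (mu nu : probability Om R) (t : R) : 0 <= t <= 1 ->
  exists rho : probability Om R, mixture t mu nu rho.
Proof.
move=> /andP[t0 t1]; have t1' : 0 <= 1 - t by rewrite subr_ge0.
pose m : {measure set Om -> \bar R} :=
  measure_add (mscale (NngNum t0) mu) (mscale (NngNum t1') nu).
have mE A : m A = (t%:E * mu A + (1 - t)%:E * nu A)%E by exact: measure_addE.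
have mT : m setT = 1%E.
  by rewrite mE !probability_setT !mule1 -EFinD addrC subrK.
pose rho : probability Om R :=
  HB.pack (Measure.sort m) (Measure_isProbability.Build _ _ _ m mT).
exists rho => A mA; rewrite [rho A]mE.
by rewrite fineD ?fineM ?fin_numM ?fin_num_measure.
Qed.

Lemma mixture_invariant (R : realType) (X : pmetricType R) (T : X -> X)
    (mu nu rho : probability (borel X) R) (t : R) : continuous T ->
    invariant_measures T mu -> invariant_measures T nu -> mixture t mu nu rho ->
  invariant_measures T rho.
Proof.
move=> cT Tmu Tnu mix A mA.
have mTA : measurable ((T : borel X -> borel X) @^-1` A).
  by rewrite -[X in measurable X]setTI; exact: continuous_measurable_map.
by rewrite -[LHS]fineK ?fin_num_measure// -[RHS]fineK ?fin_num_measure// !mix// Tmu// Tnu.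
Qed.

Lemma Rintegral_mixture (R : realType) (X : pmetricType R)
    (mu nu rho : probability (borel X) R) (t : R) (f : X -> R) :
    compact [set: X] -> 0 <= t <= 1 -> mixture t mu nu rho -> continuous f ->
  \int[rho]_x f x = t * (\int[mu]_x f x) + (1 - t) * (\int[nu]_x f x).
Proof.
move=> cX /andP[t0 t1] mix cf; have t1' : 0 <= 1 - t by rewrite subr_ge0.
pose m : {measure set (borel X) -> \bar R} :=
  measure_add (mscale (NngNum t0) mu) (mscale (NngNum t1') nu).
have [M fM] : exists M, forall x, 0 <= M + f x.
  have := compact_bounded (continuous_compact (continuous_subspaceT cf) cX).
  move=> [M [Mr hM]]; exists (`|M| + 1) => x.
  have : `|f x| <= `|M| + 1 by apply: hM; [rewrite ltr_pwDr ?ler_norm|exists x].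
  by rewrite ler_norml => /andP[]; lra.
pose g x := M + 1 * f x.
have cg : continuous g.
  by move=> x; apply: cvgD; [exact: cvg_cst|apply: cvgMr; exact: cf].
have g0 x : 0 <= g x by rewrite /g mul1r.
have intg (p : probability (borel X) R) := continuous_integrable_borel p cX cg.
have mg : measurable_fun [set: borel X] (EFin \o g).
  by apply/measurable_EFinP; exact: continuous_measurable_borel.
have gE : \int[rho]_x g x = t * (\int[mu]_x g x) + (1 - t) * (\int[nu]_x g x).
  rewrite /Rintegral (eq_measure_integral m) => [|A mA _]; last first.
    rewrite -[LHS]fineK ?fin_num_measure// mix// EFinD !EFinM.
    rewrite !fineK ?fin_num_measure//; apply: esym; exact: measure_addE.
  rewrite ge0_integral_measure_add//=; last by move=> x _; rewrite lee_fin.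
  rewrite !ge0_integral_mscale//=; try by move=> x _; rewrite lee_fin.
  have fin (p : probability (borel X) R) : (\int[p]_x (g x)%:E)%E \is a fin_num.
    exact: integrable_fin_num (intg p).
  by rewrite fineD ?fineM ?fin_numM ?fin.
move: gE; rewrite !Rintegral_affine// !mul1r; lra.
Qed.

Lemma conditional_exists d (Om : measurableType d) (R : realType)
    (nu : probability Om R) (A : set Om) : measurable A -> 0 < fine (nu A) ->
  exists mu : probability Om R, forall B, measurable B ->
    fine (mu B) = (fine (nu A))^-1 * fine (nu (B `&` A)).
Proof.
move=> mA A0; pose m : {measure set Om -> \bar R} := mrestr nu mA.
have mE B : m B = nu (B `&` A) by [].
exists (mnormalize m nu) => B mB.
transitivity (fine (mnormalize m nu B)); first by [].
rewrite /mnormalize ifF !mE setTI.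
  by rewrite fineM// ?fin_num_measure 1?mulrC//; exact: measurableI.
apply/negbTE; rewrite negb_or; apply/andP; split.
  by apply: contraTN A0 => /eqP ->; rewrite ltxx.
by rewrite lt_eqF// -ge0_fin_numE// fin_num_measure.
Qed.

(** * Entropy over the rotation set *)

Lemma cvg_weak_star (R : realType) (X : pmetricType R) (T : X -> X)
    (G : set_system (weak_star T)) (m : weak_star T) : Filter G ->
    (forall f : X -> R, continuous f ->
      (fun i : weak_star T => \int[val (i : set_type (invariant_measures T))]_x f x) @ G -->
      \int[val (m : set_type (invariant_measures T))]_x f x) ->
  G --> m.
Proof.
move=> FG Gm V; rewrite nbhsE => -[_ [ [U oU <-] Um] UV].
set F := (F in F @^-1` U) in Um UV.
have FGm : {ptws, F @ G --> F m}.
  apply/cvg_sup => f A; rewrite nbhsE => -[_ [ [B oB <-] Bm] BA].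
  apply: (filterS BA); apply: (Gm f (@cts_fun _ _ f)).
  exact: open_nbhs_nbhs.
have nU : nbhs (F m : {ptws continuousType X R -> R}) U.
  exact: open_nbhs_nbhs.
by apply: (filterS UV); exact: FGm nU.
Qed.

Section thermodynamics.
Context (R : realType) (X : pmetricType R) (T : X -> X) (d : nat).
Context (Phi : 'I_d -> X -> R).
Hypotheses (cX : compact [set: X]) (cT : continuous T).
Hypothesis cPhi : forall i, continuous (Phi i).
Implicit Types mu nu rho : probability (borel X) R.

Lemma integral_vector_mixture t mu nu rho : 0 <= t <= 1 -> mixture t mu nu rho ->
  integral_vector Phi rho =
  t *: integral_vector Phi mu + (1 - t) *: integral_vector Phi nu.
Proof.
move=> t01 mix; apply/rowP => i; rewrite !mxE.
exact: (Rintegral_mixture cX t01 mix (@cPhi i)).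
Qed.

Lemma continuous_span_function q c : continuous (span_function Phi q c).
Proof.
move=> x; apply: cvgD; last exact: cvg_cst.
by apply: cvg_sum_seq => i; apply: cvgMr; exact: cPhi.
Qed.

Lemma Rintegral_span_function mu q c :
  \int[mu]_x span_function Phi q c x =
  \sum_(i < d) q 0 i * integral_vector Phi mu 0 i + c.
Proof.
rewrite /span_function.
have -> : \int[mu]_x (\sum_(i < d) q 0 i * Phi i x + c) =
    c + 1 * \int[mu]_x (\sum_(i < d) q 0 i * Phi i x).
  rewrite -Rintegral_affine//.
    by apply: eq_Rintegral => x _; rewrite mul1r addrC.
  by move=> x; apply: cvg_sum_seq => i; apply: cvgMr; exact: cPhi.
rewrite mul1r addrC; congr (_ + _).
elim: (index_enum _) => [|i s IH].
  under eq_Rintegral do rewrite big_nil.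
  by rewrite big_nil /Rintegral integral0.
rewrite big_cons -IH; under eq_Rintegral do rewrite big_cons.
have cs : continuous (fun x => \sum_(j <- s) q 0 j * Phi j x).
  by move=> x; apply: cvg_sum_seq => j; apply: cvgMr; exact: cPhi.
have ci : continuous (fun x => q 0 i * Phi i x).
  by move=> x; apply: cvgMr; exact: cPhi.
rewrite RintegralD//; last 2 first.
- exact: continuous_integrable_borel.
- exact: continuous_integrable_borel.
congr (_ + _); rewrite mxE -[RHS]add0r -Rintegral_affine//.
by apply: eq_Rintegral => x _; rewrite add0r.
Qed.

Lemma entropy_function_attained w :
    lower_semicontinuous (fun mu : weak_star T =>
      (- ks_entropy T (val (mu : set_type (invariant_measures T))))%E) ->
    rotation_set T Phi w -> entropy_function T Phi w \is a fin_num ->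
  exists mu, [/\ invariant_measures T mu, integral_vector Phi mu = w &
    ks_entropy T mu = entropy_function T Phi w].
Proof.
move=> usc [mu1 Tmu1 mu1w] hfin; set h := entropy_function T Phi w.
pose M : topologicalType := weak_star T.
pose v (i : M) : probability (borel X) R := val (i : set_type (invariant_measures T)).
pose B (c : R) : set M :=
  [set i | integral_vector Phi (v i) = w /\ (c%:E < ks_entropy T (v i))%E].
pose D : set R := [set c | (c%:E < h)%E].
have PF : ProperFilter (filter_from D B).
  apply: filter_from_proper; last first.
    move=> c /ereal_sup_gt[_ [mu [Tmu muw] <-] cmu].
    by exists (SigSub (mem_set Tmu) : set_type (invariant_measures T)); split.
  apply: filter_from_filter.
    exists (fine h - 1); rewrite /D/= -[ltRHS]fineK// lte_fin; lra.
  move=> c c' Dc Dc'; exists (Num.max c c').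
    by rewrite /D/= EFin_max gt_max Dc.
  by move=> i [iw]; rewrite EFin_max gt_max => /andP[ci c'i]; split; split.
have [G [UG BG]] := ultraFilterLemma PF.
have [mu [mulim muT]] := @ultra_limit_measure R X cX M G v UG.
have Tmu : invariant_measures T mu.
  by apply: muT => // i; exact: set_mem (valP (i : set_type _)).
pose m : M := (SigSub (mem_set Tmu) : set_type (invariant_measures T)).
have Gm : G --> m by apply: cvg_weak_star => f cf; exact: mulim.
have muw : integral_vector Phi mu = w.
  apply/rowP => i; rewrite mxE.
  apply: (cvg_unique _ (mulim _ (@cPhi i))) => //.
  apply: cvg_near_cst; apply: BG; exists (fine h - 1).
    rewrite /D/= -[ltRHS]fineK// lte_fin; lra.
  by move=> j [<- _]; rewrite mxE.
exists mu; split => //; apply/eqP; rewrite eq_le; apply/andP; split.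
  by apply: ereal_sup_ubound; exists mu.
rewrite leNgt; apply/negP => muh.
have ks0 : (0 <= ks_entropy T mu)%E by exact: ks_entropy_ge0.
have ksfin : ks_entropy T mu \is a fin_num.
  by rewrite ge0_fin_numE// (lt_le_trans muh)// leey.
pose c : R := (fine (ks_entropy T mu) + fine h) / 2.
have : fine (ks_entropy T mu) < fine h by rewrite fine_lt.
move=> lt_fine.
have muc : (ks_entropy T mu < c%:E)%E.
  by rewrite -[ltLHS]fineK// lte_fin /c; lra.
have ch : (c%:E < h)%E by rewrite -[ltRHS]fineK// lte_fin /c; lra.
have [|V mV Vc] := usc m (- c); first by rewrite EFinN lteN2.
have GV : G V by exact: Gm.
have GB : G (B c) by apply: BG; exists c.
have [i [Vi [_ ci]]] := filter_ex (filterI GV GB).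
by have := Vc _ Vi; rewrite EFinN lteN2 => /(lt_trans ci); rewrite ltxx.
Qed.

End thermodynamics.

Section rotation_entropy.
Context (R : realType) (X : pmetricType R) (T : X -> X) (d : nat).
Context (Phi : 'I_d -> X -> R).
Hypotheses (cX : compact [set: X]) (cT : continuous T).
Hypothesis cPhi : forall i, continuous (Phi i).
Implicit Types mu nu rho : probability (borel X) R.
Local Notation L := (rotation_set T Phi).
Local Notation h := (entropy_function T Phi).

Lemma rotation_set_convex x y t : L x -> L y -> 0 < t < 1 ->
  L (t *: x + (1 - t) *: y).
Proof.
move=> [mu Tmu <-] [nu Tnu <-] /andP[t0 t1].
have t01 : 0 <= t <= 1 by rewrite !ltW.
have [rho mix] := mixture_exists mu nu t01.
exists rho; first exact: mixture_invariant mix.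
exact: integral_vector_mixture mix.
Qed.

Lemma le_entropy_function mu : invariant_measures T mu ->
  (ks_entropy T mu <= h (integral_vector Phi mu))%E.
Proof. by move=> Tmu; apply: ereal_sup_ubound; exists mu. Qed.

Hypothesis hfin : forall w, L w -> h w \is a fin_num.

Lemma ks_entropy_fin_num mu : invariant_measures T mu ->
  ks_entropy T mu \is a fin_num.
Proof.
move=> Tmu; rewrite ge0_fin_numE ?ks_entropy_ge0//.
apply: (le_lt_trans (le_entropy_function Tmu)); rewrite ltey_eq.
by rewrite hfin//; exists mu.
Qed.

Lemma entropy_function_concave x y t : L x -> L y -> 0 < t < 1 ->
  t * fine (h x) + (1 - t) * fine (h y) <= fine (h (t *: x + (1 - t) *: y)).
Proof.
move=> Lx Ly t01; have /andP[t0 t1] := t01.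
have Lxy := rotation_set_convex Lx Ly t01.
have t01' : 0 <= t <= 1 by rewrite !ltW.
have t1' : 0 < 1 - t by rewrite subr_gt0.
have key mu nu : invariant_measures T mu -> integral_vector Phi mu = x ->
    invariant_measures T nu -> integral_vector Phi nu = y ->
    t * fine (ks_entropy T mu) + (1 - t) * fine (ks_entropy T nu) <=
    fine (h (t *: x + (1 - t) *: y)).
  move=> Tmu mux Tnu nuy; have [rho mix] := mixture_exists mu nu t01'.
  have Trho := mixture_invariant cT Tmu Tnu mix.
  have := ks_entropy_mixture_ge cT Tmu Tnu Trho t01 mix.
  have := le_entropy_function Trho.
  rewrite (integral_vector_mixture cX cPhi t01' mix) mux nuy.
  move=> h1 h2; rewrite -lee_fin EFinD !EFinM !fineK ?ks_entropy_fin_num ?hfin//.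
  exact: le_trans h1.
have bnd w a : L w -> (forall mu, invariant_measures T mu ->
    integral_vector Phi mu = w -> fine (ks_entropy T mu) <= a) -> fine (h w) <= a.
  move=> Lw H; rewrite -lee_fin fineK ?hfin//; apply/ereal_supP => _ [mu [Tmu muw] <-].
  by rewrite -[leLHS]fineK ?ks_entropy_fin_num// lee_fin H.
rewrite -lerBrDr -ler_pdivlMl//; apply: (bnd) => // mu Tmu mux.
rewrite ler_pdivlMl// lerBrDl -lerBrDr -ler_pdivlMl//; apply: (bnd) => // nu Tnu nuy.
by rewrite ler_pdivlMl// lerBrDr addrC key.
Qed.

End rotation_entropy.

Section uniqueness_consequences.
Context (R : realType) (X : pmetricType R) (T : X -> X) (d : nat).
Context (Phi : 'I_d -> X -> R).
Hypotheses (cX : compact [set: X]) (cT : continuous T).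
Hypothesis cPhi : forall i, continuous (Phi i).
Hypothesis d_gt0 : (0 < d)%N.
Hypothesis uniq_eq : forall (q : 'rV[R]_d) (c : R),
  unique_measure (classical_equilibrium T (span_function Phi q c)).
Implicit Types mu nu rho : probability (borel X) R.
Local Notation L := (rotation_set T Phi).
Local Notation h := (entropy_function T Phi).

Lemma unique_measure_eq (P : set (probability (borel X) R)) mu nu :
  unique_measure P -> P mu -> P nu -> measure_eq mu nu.
Proof. by move=> [m _ mP] Pmu Pnu A mA; rewrite (mP _ Pmu)// (mP _ Pnu). Qed.

(* A measure [mu] of infinite entropy, and its average with any invariant
   [nu], would both be equilibrium measures for every potential, forcing
   [nu = mu] and a one-point rotation set. *)
Lemma ks_entropy_lty z mu : (rotation_set T Phi)° z ->
  invariant_measures T mu -> (ks_entropy T mu < +oo)%E.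
Proof.
move=> Lz Tmu; rewrite ltey; apply/negP => /eqP muoo.
pose psi := span_function Phi 0 0.
have half01 : 0 < (1 / 2 : R) < 1 by lra.
have half01' : 0 <= (1 / 2 : R) <= 1 by lra.
have Eoo rho : invariant_measures T rho -> ks_entropy T rho = +oo%E ->
    classical_equilibrium T psi rho.
  move=> Trho rhooo; split => //; rewrite rhooo addye//; apply/esym/eqP.
  rewrite -leye_eq; apply: ereal_sup_ubound; exists mu => //.
  by rewrite muoo addye.
have L1 w : L w -> w = integral_vector Phi mu.
  move=> [nu Tnu <-]; have [rho mix] := mixture_exists mu nu half01'.
  have Trho := mixture_invariant cT Tmu Tnu mix.
  have rhooo : ks_entropy T rho = +oo%E.
    apply/eqP; rewrite -leye_eq.
    apply: le_trans (ks_entropy_mixture_ge cT Tmu Tnu Trho half01 mix).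
    have half0 : 0 < (1 / 2 : R) by lra.
    have half0' : 0 <= 1 - (1 / 2 : R) by lra.
    rewrite muoo gt0_muley ?lte_fin// addye//.
    rewrite gt_eqF//; apply: (@lt_le_trans _ _ 0%E) => //.
    by rewrite mule_ge0 ?ks_entropy_ge0.
  have := unique_measure_eq (uniq_eq 0 0) (Eoo _ Tmu muoo) (Eoo _ Trho rhooo).
  move=> murho; apply/rowP => i; rewrite !mxE /Rintegral; congr fine.
  apply: eq_measure_integral => A mA _.
  rewrite -[LHS]fineK ?fin_num_measure// -[RHS]fineK ?fin_num_measure//.
  by congr (_%:E); have := mix _ mA; rewrite -murho//; lra.
have [s s0 Lzs] := interior_ray (const_mx 1) Lz.
have := L1 _ Lzs; rewrite -(L1 _ (interior_subset Lz)) => /rowP/(_ (Ordinal d_gt0)).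
rewrite !mxE; lra.
Qed.

Lemma entropy_function_fin_num z w : (rotation_set T Phi)° z -> L w ->
  h w \is a fin_num.
Proof.
move=> Lz [mu Tmu muw].
have [m [Tm mE] _] := uniq_eq 0 0.
have span0 nu : \int[nu]_x span_function Phi 0 0 x = 0.
  by rewrite Rintegral_span_function// addr0 big1// => i _; rewrite mxE mul0r.
have hle : (h w <= ks_entropy T m)%E.
  apply/ereal_supP => _ [nu [Tnu _] <-].
  move: mE; rewrite span0 adde0 => ->; apply: ereal_sup_ubound.
  by exists nu => //; rewrite span0 adde0.
rewrite ge0_fin_numE.
  by apply: (le_lt_trans hle); exact: ks_entropy_lty Lz Tm.
apply: (le_trans (ks_entropy_ge0 cT Tmu)); rewrite -muw.
exact: le_entropy_function.
Qed.

End uniqueness_consequences.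

Lemma conditional_measure_invariant (R : realType) (X : pmetricType R) (T : X -> X)
    (nu mu : probability (borel X) R) (A : set (borel X)) (a : R) :
    continuous T -> invariant_measures T nu -> measurable A -> T @^-1` A = A ->
    (forall B, measurable B -> fine (mu B) = a * fine (nu (B `&` A))) ->
  invariant_measures T mu.
Proof.
move=> cT Tnu mA TA muE B mB.
have mTB : measurable ((T : borel X -> borel X) @^-1` B).
  by rewrite -[X in measurable X]setTI; exact: continuous_measurable_map.
rewrite -[LHS]fineK ?fin_num_measure// -[RHS]fineK ?fin_num_measure// !muE//.
by rewrite -{1}TA -preimage_setI Tnu//; exact: measurableI.
Qed.

(* If [A] were a non-trivial invariant set, the conditional measures on [A] and
   its complement would both be equilibrium measures, as the entropy is affine. *)
Lemma unique_classical_equilibrium_ergodic (R : realType) (X : pmetricType R)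
    (T : X -> X) (psi : X -> R) (nu : probability (borel X) R) :
    compact [set: X] -> continuous T -> continuous psi ->
    unique_measure (classical_equilibrium T psi) ->
    (forall mu, invariant_measures T mu -> ks_entropy T mu \is a fin_num) ->
  classical_equilibrium T psi nu -> ergodic T nu.
Proof.
move=> cX cT cpsi uniq ksfin nueq; have [Tnu supE] := nueq; split => // A mA TA.
have mCA : measurable (~` A) by exact: measurableC.
set t := fine (nu A).
have nuA : nu A = t%:E by rewrite fineK// fin_num_measure.
have nuCA : fine (nu (~` A)) = 1 - t by rewrite probability_setC// nuA.
have t0 : 0 <= t by exact: fine_ge0.
have t1 : 0 <= 1 - t by rewrite -nuCA; exact: fine_ge0.
have [tE|tN0] := eqVneq t 0; first by left; rewrite nuA tE.
have [tE|tN1] := eqVneq t 1; first by right; rewrite nuA tE.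
have {}t0 : 0 < t by rewrite lt_neqAle eq_sym tN0.
have {}t1 : 0 < 1 - t by rewrite lt_neqAle t1 andbT eq_sym subr_eq0 eq_sym.
have t01 : 0 < t < 1 by rewrite t0/=; move: t1; rewrite subr_gt0.
have t01' : 0 <= t <= 1 by have /andP[? ?] := t01; rewrite !ltW.
have nuCA0 : 0 < fine (nu (~` A)) by rewrite nuCA.
have [m1 m1E] := conditional_exists mA t0.
have [m2 m2E] := conditional_exists mCA nuCA0.
have Tm1 := conditional_measure_invariant cT Tnu mA TA m1E.
have TCA : T @^-1` (~` A) = ~` (T @^-1` A) by [].
rewrite TA in TCA.
have Tm2 := conditional_measure_invariant cT Tnu mCA TCA m2E.
have mix : mixture t m1 m2 nu.
  move=> B mB; rewrite m1E// m2E// nuCA !mulrA !divff ?gt_eqF// !mul1r.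
  rewrite -fineD ?fin_num_measure//; try exact: measurableI.
  rewrite -measureU; try exact: measurableI.
    by rewrite -setIUr setUv setIT.
  by rewrite setIACA setICr setI0.
pose J mu := fine (ks_entropy T mu) + \int[mu]_x psi x.
have JE mu : invariant_measures T mu ->
    (ks_entropy T mu + (\int[mu]_x psi x)%:E)%E = (J mu)%:E.
  by move=> Tmu; rewrite EFinD (fineK (ksfin _ Tmu)).
have J_le mu : invariant_measures T mu -> J mu <= J nu.
  move=> Tmu; rewrite -lee_fin -!JE// supE; apply: ereal_sup_ubound.
  by exists mu.
have Jnu : J nu <= t * J m1 + (1 - t) * J m2.
  rewrite /J (Rintegral_mixture cX t01' mix cpsi).
  have := ks_entropy_mixture_le cT Tm1 Tm2 Tnu t01 mix.
  rewrite -(fineK (ksfin _ Tnu)) -(fineK (ksfin _ Tm1)) -(fineK (ksfin _ Tm2)).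
  by rewrite -!EFinM -EFinD lee_fin; lra.
have Jm1 : J m1 = J nu.
  have h2 : (1 - t) * J m2 <= (1 - t) * J nu by rewrite ler_pM2l// J_le.
  apply/eqP; rewrite eq_le (J_le _ Tm1)/= -(ler_pM2l t0).
  move: Jnu h2; move: (J nu) (J m1) (J m2) => a b c; lra.
have m1eq : classical_equilibrium T psi m1 by split => //; rewrite -supE !JE// Jm1.
have := m1E _ mA; rewrite (unique_measure_eq uniq m1eq nueq mA) setIid.
by rewrite -/t mulVf// => tE; rewrite tE eqxx in tN1.
Qed.

Theorem theorem10 (R : realType) (X : pmetricType R) (T : X -> X)
    (d : nat) (Phi : 'I_d -> X -> R) (r : smoothness) (F : 'rV[R]_d -> R)
    (X_compact : compact [set: X])
    (T_continuous : continuous T)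
    (d_gt0 : (0 < d)%N)
    (Phi_continuous : forall i, continuous (Phi i))
    (r_ge2 : at_least_C2 r)
    (regular : regular_pair T Phi r)
    (F_strictly_concave : strictly_concave_on (rotation_set T Phi) F)
    (F_smooth : Cr_on r (rotation_set T Phi) F)
    (E_max : exists2 z : 'rV[R]_d, (rotation_set T Phi)° z &
      forall w : 'rV[R]_d, rotation_set T Phi w ->
        (entropy_function T Phi w + (F w)%:E <=
         entropy_function T Phi z + (F z)%:E)%E) :
  exists nu : probability (borel X) R,
    [/\ equilibrium_measure T F Phi nu,
        forall nu' : probability (borel X) R,
          equilibrium_measure T F Phi nu' -> measure_eq nu' nu
      & ergodic T nu].
Proof.
have [uniq _ usc] := regular; have [z Lz z_max] := E_max.
set L := rotation_set T Phi in Lz z_max *.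
have LLz : L z by exact: interior_subset.
set h := entropy_function T Phi in z_max *.
have hfin w : L w -> h w \is a fin_num.
  exact: (entropy_function_fin_num X_compact T_continuous Phi_continuous d_gt0 uniq Lz).
have ksfin := ks_entropy_fin_num T_continuous hfin.
pose g w := fine (h w).
have h_ge mu : invariant_measures T mu ->
    fine (ks_entropy T mu) <= g (integral_vector Phi mu).
  move=> Tmu; rewrite fine_le ?ksfin ?hfin//; first by exists mu.
  exact: le_entropy_function.
have g_max w : L w -> g w + F w <= g z + F z.
  move=> Lw; rewrite -lee_fin !EFinD /g !fineK ?hfin//; exact: z_max.
have g_concave x y t (Lx : L x) (Ly : L y) (t01 : 0 < t < 1) :
    t * g x + (1 - t) * g y <= g (t *: x + (1 - t) *: y) :=
  entropy_function_concave X_compact T_continuous Phi_continuous hfin Lx Ly t01.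
have L_convex x y t (Lx : L x) (Ly : L y) (t01 : 0 < t < 1) :=
  rotation_set_convex X_compact T_continuous Phi_continuous Lx Ly t01.
have [q qP] := concave_superdifferential Lz g_concave L_convex.
have [nu [Tnu nuz nuh]] := entropy_function_attained X_compact T_continuous
  Phi_continuous usc LLz (hfin _ LLz).
pose psi := span_function Phi q 0.
have cpsi : continuous psi by exact: continuous_span_function.
have psiE mu : invariant_measures T mu ->
    (ks_entropy T mu + (\int[mu]_x psi x)%:E)%E =
    (fine (ks_entropy T mu) + \sum_(i < d) q 0 i * integral_vector Phi mu 0 i)%:E.
  by move=> Tmu; rewrite Rintegral_span_function// addr0 EFinD (fineK (ksfin _ Tmu)).
have psi_eq mu : invariant_measures T mu -> integral_vector Phi mu = z ->
    fine (ks_entropy T mu) = g z -> classical_equilibrium T psi mu.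
  move=> Tmu muz muh; split => //; apply/eqP; rewrite eq_le; apply/andP; split.
    by apply: ereal_sup_ubound; exists mu.
  apply/ereal_supP => _ [mu' Tmu' <-]; rewrite !psiE// lee_fin muz muh.
  have Lmu' : L (integral_vector Phi mu') by exists mu'.
  have := qP _ Lmu'; under eq_bigr do rewrite mulrBr.
  by rewrite sumrB; have := h_ge _ Tmu'; lra.
have FE mu : invariant_measures T mu ->
    (ks_entropy T mu + (F (integral_vector Phi mu))%:E)%E =
    (fine (ks_entropy T mu) + F (integral_vector Phi mu))%:E.
  by move=> Tmu; rewrite EFinD (fineK (ksfin _ Tmu)).
have nug : fine (ks_entropy T nu) = g z by rewrite nuh.
have supE : ereal_sup [set (ks_entropy T mu + (F (integral_vector Phi mu))%:E)%E
    | mu in invariant_measures T] = (g z + F z)%:E.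
  apply/eqP; rewrite eq_le; apply/andP; split.
    apply/ereal_supP => _ [mu Tmu <-]; rewrite FE// lee_fin.
    have Lmu : L (integral_vector Phi mu) by exists mu.
    by have := h_ge _ Tmu; have := g_max _ Lmu; lra.
  by apply: ereal_sup_ubound; exists nu => //; rewrite FE// nug nuz.
exists nu; split.
- by split => //; rewrite supE FE// nug nuz.
- move=> nu' [Tnu']; rewrite supE FE// => -[nu'E].
  have Lnu' : L (integral_vector Phi nu') by exists nu'.
  have nu'z : integral_vector Phi nu' = z.
    apply/eqP/negPn/negP => wz; set w := integral_vector Phi nu' in nu'E wz Lnu'.
    have half01 : 0 < (1 / 2 : R) < 1 by lra.
    have := F_strictly_concave _ _ _ Lnu' LLz wz half01.
    have := g_max _ (L_convex _ _ _ Lnu' LLz half01).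
    have := g_concave _ _ _ Lnu' LLz half01.
    have := h_ge _ Tnu'; rewrite -/w.
    by move: nu'E; set y := _ *: _ + _; lra.
  apply: (unique_measure_eq (uniq q 0)); last exact: psi_eq.
  apply: psi_eq => //; move: nu'E; rewrite nu'z; lra.
- apply: (unique_classical_equilibrium_ergodic X_compact T_continuous cpsi (uniq q 0)).
    exact: ksfin.
  exact: psi_eq.
Qed.
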